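(* Assume $Q$ is ergodic. Let $x\in\mathbb R_+^{\mathcal R}$ and $D\in\mathbb R^{\Lambda(x)}$. Then $$\lim_{\tau\to0}\lim_{\delta\to0}\lim_{\epsilon\to0}\liminf_{n\to\infty}\frac1{n\tau}\inf_{y\in\mathbb Z_+^{\mathcal R},\,|y-nx|<\epsilon n}\log\mathbb P\Big[\sup_{t\in[0,n\tau]}|Q(t,y)-nx-Dt|<\delta n\Big]$$ $$=\lim_{\tau\to0}\lim_{\delta\to0}\lim_{\epsilon\to0}\limsup_{n\to\infty}\frac1{n\tau}\sup_{y\in\mathbb Z_+^{\mathcal R},\,|y-nx|<\epsilon n}\log\mathbb P\Big[\sup_{t\in[0,n\tau]}|Q(t,y)-nx-Dt|<\delta n\Big]=-L(x,D),$$ where $$L(x,D)=\sum_{ij\in\Lambda(x)\cup\Lambda_1(x)} l\big(D_{ij}\,\|\,\lambda_{ij},\mu_{ij}(x)\big).$$ Moreover, if a face $\Lambda$ and a drift $D\in\mathbb R^\Lambda$ are fixed, the limit in $\tau$ is uniform with respect to $x$ in compact subsets of the face $\Lambda$.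
   Context: Star network: $\mathcal S=\{1,\dots,N\}$ is a set of channels with capacities $C_i>0$. Routes are unordered pairs $ij=ji$ of distinct channels; each route has arrival rate $\lambda_{ij}\ge0$ and a parameter $\mu_{ij}>0$; $\mathcal R=\{ij:\lambda_{ij}>0\}$ is the set of active routes. For $x\in\mathbb R_+^{\mathcal R}$ write $x_i=\sum_{j:ij\in\mathcal R}x_{ij}$, $\nu_{ij}(x)=x_{ij}\,(C_i/x_i\wedge C_j/x_j)$ if $x_{ij}>0$ and $\nu_{ij}(x)=0$ otherwise, and $\mu_{ij}(x)=\mu_{ij}\nu_{ij}(x)$ (min policy). $Q(t,y)$, $t\ge0$, is the continuous-time Markov jump process on $\mathbb Z_+^{\mathcal R}$ started at $y$ which jumps from $x$ to $x+e_{ij}$ at rate $\lambda_{ij}$ and from $x$ to $x-e_{ij}$ at rate $\mu_{ij}(x)$ ($ij\in\mathcal R$); $\mathbb P$ is its law. ''$Q$ is ergodic'' means $\sum_{j:ij\in\mathcal R}\lambda_{ij}/\mu_{ij}<C_i$ for every $i\in\mathcal S$. $|\cdot|$ is a norm on $\mathbb R^{\mathcal R}$. Faces: for $x\in\mathbb R_+^{\mathcal R}$, $\Lambda(x)=\{ij\in\mathcal R:x_{ij}>0\}$. For $\Lambda\subset\mathcal R$, $\Lambda_1=\{ij\in\mathcal R\setminus\Lambda:\exists k\in\mathcal S,\ ik\in\Lambda\text{ or }jk\in\Lambda\}$ and $\Lambda_2=\mathcal R\setminus(\Lambda\cup\Lambda_1)$; $\Lambda_1(x),\Lambda_2(x)$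 are these sets for $\Lambda=\Lambda(x)$. $\mathbb R^\Lambda=\{D\in\mathbb R^{\mathcal R}:D_{ij}=0\ \forall ij\notin\Lambda\}$. The ''face $\Lambda$'' also denotes the set $\{y\in\mathbb R_+^{\mathcal R}:y_{ij}>0\ \forall ij\in\Lambda,\ y_{ij}=0\ \forall ij\notin\Lambda\}$. For $\lambda>0,\mu\ge0$ and real $D$ (with $D\ge0$ if $\mu=0$), $$l(D\|\lambda,\mu)=D\log\Big(\frac{D+\sqrt{D^2+4\lambda\mu}}{2\lambda}\Big)+\lambda+\mu-\sqrt{D^2+4\lambda\mu},$$ with the convention $0\log0=0$ (so $l(0\|\lambda,0)=\lambda$). *)

(* Defs.v *)
From mathcomp Require Import all_boot all_order all_algebra.
From mathcomp Require Import all_classical all_reals all_analysis.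
Import numFieldNormedType.Exports.
Import Order.TTheory GRing.Theory Num.Theory.

Set Implicit Arguments.
Unset Strict Implicit.
Unset Printing Implicit Defensive.

Local Open Scope classical_set_scope.
Local Open Scope ring_scope.

(* Channels are 'I_N; a route is an unordered pair of distinct channels,
   represented canonically as an ordered pair (i, j) with i < j. *)
Definition route (N : nat) := {p : 'I_N * 'I_N | (p.1 < p.2)%N}.

Definition onr (N : nat) (i : 'I_N) (r : route N) : bool :=
  (i == (val r).1) || (i == (val r).2).

Definition shares (N : nat) (r r' : route N) : bool :=
  [exists i, onr i r && onr i r'].

(* the log-cost l(D || lambda, mu); with 0 log 0 = 0 (note ln 0 = 0 in
   mathcomp-analysis and the factor D = 0 kills the log term anyway) *)
Definition lfun (R : realType) (D la m : R) : R :=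
  D * ln ((D + Num.sqrt (D ^+ 2 + 4 * la * m)) / (2 * la))
  + la + m - Num.sqrt (D ^+ 2 + 4 * la * m).

Definition elog (R : realType) (p : \bar R) : \bar R :=
  if p == 0%E then -oo%E else (ln (fine p))%:E.

Definition is_norm (R : realType) (T : Type) (nrm : (T -> R) -> R) : Prop :=
  [/\ forall v, nrm v = 0 -> v = (fun _ => 0),
      forall (a : R) v, nrm (fun t => a * v t) = `|a| * nrm v
    & forall v w, nrm (fun t => v t + w t) <= nrm v + nrm w].

Section Star.
Variables (R : realType) (N : nat) (C : 'I_N -> R) (lam mu : route N -> R).

Definition act := {r : route N | 0 < lam r}.

Definition load (x : act -> R) (i : 'I_N) : R :=
  \sum_(r : act | onr i (val r)) x r.

Definition nu (x : act -> R) (r : act) : R :=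
  if 0 < x r then
    x r * Num.min (C (val (val r)).1 / load x (val (val r)).1)
                  (C (val (val r)).2 / load x (val (val r)).2)
  else 0.

Definition muX (x : act -> R) (r : act) : R := mu (val r) * nu x r.

Definition ergodic : Prop :=
  forall i : 'I_N, \sum_(r : act | onr i (val r)) lam (val r) / mu (val r) < C i.

Definition supp (x : act -> R) : pred act := fun r => 0 < x r.

Definition Lambda1 (L : pred act) : pred act :=
  fun r => ~~ L r && [exists r' : act, L r' && shares (val r) (val r')].

Definition face (L : pred act) : set (act -> R) :=
  [set y | forall r, (0 < y r /\ L r) \/ (y r = 0 /\ ~~ L r)].

Definition in_span (L : pred act) (D : act -> R) : Prop :=
  forall r, ~~ L r -> D r = 0.

Definition Lrate (x D : act -> R) : R :=
  \sum_(r : act | supp x r || Lambda1 (supp x) r)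
     lfun (D r) (lam (val r)) (muX x r).

Definition embed (z : act -> nat) : act -> R := fun r => (z r)%:R.

Definition up (z : act -> nat) (r : act) : act -> nat :=
  fun r' => if r' == r then (z r').+1 else z r'.
Definition down (z : act -> nat) (r : act) : act -> nat :=
  fun r' => if r' == r then (z r').-1 else z r'.

Definition qrate (z : act -> nat) : R :=
  \sum_(r : act) (lam (val r) + muX (embed z) r).

Variable nrm : (act -> R) -> R.

Definition tube (a D : act -> R) (c : R) (z : act -> nat) (s u : R) : Prop :=
  forall t : R, s <= t <= u -> nrm (fun r => embed z r - a r - D r * t) < c.

(* Pk k T a D c z s = probability that the jump process, started at state z
   at time s <= T, makes at most k jumps in [s, T] and satisfies
   |Q(t) - a - D t| < c for all t in [s, T].  This is the standard
   jump-chain / exponential-holding-time construction of the (minimal)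
   Markov jump process with the given rates. *)
Fixpoint Pk (k : nat) (T : R) (a D : act -> R) (c : R)
  (z : act -> nat) (s : R) {struct k} : \bar R :=
  match k with
  | 0 => (expR (- qrate z * (T - s)) * (`[< tube a D c z s T >])%:R)%:E
  | k'.+1 =>
      ((expR (- qrate z * (T - s)) * (`[< tube a D c z s T >])%:R)%:E +
       \int[@lebesgue_measure R]_(u in `[s, T])
          ((expR (- qrate z * (u - s)) * (`[< tube a D c z s u >])%:R)%:E *
           \sum_(r : act)
              ((lam (val r))%:E * Pk k' T a D c (up z r) u +
               (muX (embed z) r)%:E * Pk k' T a D c (down z r) u)))%E
  end.

(* P[ sup_{t in [0,T]} |Q(t,y) - a - D t| < c ]  (the process has finitely
   many jumps on [0,T] a.s., so this is the increasing limit in k) *)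
Definition tubeProb (T : R) (a D : act -> R) (c : R) (y : act -> nat) : \bar R :=
  ereal_sup (range (fun k => Pk k T a D c y 0)).

Definition startset (x : act -> R) (eps : R) (n : nat) : set (act -> nat) :=
  [set y | nrm (fun r => embed y r - n%:R * x r) < eps * n%:R].

Definition logP (x D : act -> R) (tau delta : R) (n : nat) (y : act -> nat) : \bar R :=
  elog (tubeProb (n%:R * tau) (fun r => n%:R * x r) D (delta * n%:R) y).

Definition seq_inf (x D : act -> R) (tau delta eps : R) (n : nat) : \bar R :=
  (((n%:R * tau)^-1)%:E * ereal_inf (logP x D tau delta n @` startset x eps n))%E.

Definition seq_sup (x D : act -> R) (tau delta eps : R) (n : nat) : \bar R :=
  (((n%:R * tau)^-1)%:E * ereal_sup (logP x D tau delta n @` startset x eps n))%E.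

Definition J1inf x D tau delta eps : \bar R := limn_einf (seq_inf x D tau delta eps).
Definition J1sup x D tau delta eps : \bar R := limn_esup (seq_sup x D tau delta eps).

(* the iterated limits eps -> 0, then delta -> 0 (as values; existence is
   asserted separately in the theorem) *)
Definition J2inf x D tau delta : \bar R := lim (J1inf x D tau delta eps @[eps --> 0^'+]).
Definition J2sup x D tau delta : \bar R := lim (J1sup x D tau delta eps @[eps --> 0^'+]).
Definition J3inf x D tau : \bar R := lim (J2inf x D tau delta @[delta --> 0^'+]).
Definition J3sup x D tau : \bar R := lim (J2sup x D tau delta @[delta --> 0^'+]).

End Star.

(* Main.v *)
Require Import Defs.
From mathcomp Require Import all_boot all_order all_algebra.
From mathcomp Require Import all_classical all_reals all_analysis.
From mathcomp Require Import ring lra.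
Import numFieldNormedType.Exports.
Import Order.TTheory GRing.Theory Num.Theory.

Set Implicit Arguments.
Unset Strict Implicit.
Unset Printing Implicit Defensive.

Local Open Scope classical_set_scope.
Local Open Scope ring_scope.

(* The tube probability solves the backward equation of the jump process
   killed outside the tube, so it lies below every supersolution and above
   every subsolution of that equation.

   Upper bound: the supersolution exp(al (T - u) + <th, z - n x - D u>), where
   th is the optimal tilt of the Legendre transform on Lambda, very negative on
   Lambda_1 and 0 on Lambda_2.

   Lower bound: the subsolution exp(- c (T - u) - phi(z, u)) - b, where phi is
   n times a steep confining potential centred at n x + D u, quadratic on
   Lambda and Lambda_1 and a high power of z_r / rho_r on Lambda_2.  By Legendre
   duality a route of Lambda costs at most l(D || lam, mu) per unit time whatever
   the slope of phi is; on Lambda_1 a potential increasing in z_r costs at most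
   lam; on Lambda_2 ergodicity makes the cost negligible, because the routes
   with the largest z_r / rho_r are served faster than they are fed.  The
   constant b makes the subsolution negative off the tube and is exponentially
   negligible at the starting point. *)

(* [down] would otherwise be the one of [classical_sets]. *)
Local Notation down := Defs.down.

(** * Comparison principles for the tube probability *)

(** The service rates depend on a state only through the ratios of [x r] to the loads, so they are
    homogeneous of degree 0: [z] may be replaced by [z / n], and near [x] they vary little at each
    channel whose load is bounded below. This settles Lambda and Lambda_1. At a channel without load
    in [x] the ratios have no limit, so no frozen rate exists on Lambda_2; hence a stability
    argument and a potential of another kind there.

    No change of measure is made for the lower bound. The set where the subsolution is nonnegative
    acts as the domain that confines the process, and its inequalities are required only there.

    The range of [tau] depends on [x] only through bounds [m <= x r <= B] on Lambda. Uniformity on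
    compact sets is thus the basic statement, and the pointwise limit is its case of a single point.
    The limits in [eps] and [delta] exist by monotonicity.

    The comparisons bound the iterated integrals in [Pk] without proving their integrands
    measurable: the integral of a nonnegative function is a supremum over the simple functions below
    it, so pointwise order suffices. *)

Lemma ge0_integral_mono d (T : measurableType d) (R : realType)
    (mu : {measure set T -> \bar R}) (D : set T) (f g : T -> \bar R) :
  (forall x, D x -> (0 <= f x)%E) -> (forall x, D x -> (f x <= g x)%E) ->
  (\int[mu]_(x in D) f x <= \int[mu]_(x in D) g x)%E.
Proof.
move=> f0 fg; rewrite !ge0_integralE//; last first.
  by move=> x Dx; exact: le_trans (f0 _ Dx) (fg _ Dx).
apply: ereal_sup_le => _ [h hf <-]; exists h => // x.
apply: le_trans (hf x) _; rewrite !patchE; case: ifPn => // /set_mem; exact: fg.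
Qed.

(** [f] may change sign, so only its positive part is compared; nonnegativity of [g] pays for the
    part of [B] outside [A]. This lets the subsolution argument stop integrating early. *)
Lemma integral_mono_subset d (T : measurableType d) (R : realType)
    (mu : {measure set T -> \bar R}) (A B : set T) (f g : T -> \bar R) :
  A `<=` B -> (forall x, B x -> (0 <= g x)%E) -> (forall x, A x -> (f x <= g x)%E) ->
  (\int[mu]_(x in A) f x <= \int[mu]_(x in B) g x)%E.
Proof.
move=> AB g0 fg; rewrite integralE.
have h : (0 <= \int[mu]_(x in A) f^\- x)%E by apply: integral_ge0.
apply: (@le_trans _ _ (\int[mu]_(x in A) f^\+ x)%E).
  by rewrite geeDl// oppe_le0.
rewrite integral_mkcond [leRHS]integral_mkcond; apply: ge0_integral_mono => x _.
  by rewrite patchE; case: ifP.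
rewrite !patchE; case: ifPn => [/set_mem Ax|_].
  by rewrite (mem_set (AB _ Ax)) funeposE ge_max fg// g0//; exact: AB.
by case: ifPn => // /set_mem; exact: g0.
Qed.

(** Between jumps the state is frozen, so the time at which a subsolution ceases to be nonnegative
    is deterministic. It is the least point of the compact set of zeros in [[s, T]], or [T] if there
    is none; the intermediate value theorem excludes an earlier negative value. *)
Lemma first_zero (R : realType) (f : R -> R) (s T : R) :
  continuous f -> s <= T -> 0 <= f s ->
  exists sg, [/\ s <= sg <= T, forall u, s <= u <= sg -> 0 <= f u &
    f sg = 0 \/ sg = T].
Proof.
move=> cf sT fs.
have ivt u : s <= u -> f u < 0 -> exists2 v, s <= v <= u & f v = 0.
  move=> su fu; have [||v] := @IVT _ f s u 0 su.
  - exact: continuous_subspaceT.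
  - by rewrite ge_min le_max (ltW fu) fs orbT.
  - by rewrite in_itv/= => uv fv; exists v.
pose S := `[s, T]%classic `&` f @^-1` [set 0].
have [[t St]|S0] := pselect (S !=set0); last first.
  exists T; split; [by rewrite sT lexx| |by right] => u /andP[su uT].
  rewrite leNgt; apply/negP => /(ivt _ su)[v /andP[sv vu] fv].
  by apply: S0; exists v; split => //=; rewrite in_itv/= sv (le_trans vu).
have cS : compact S.
  apply: (@subclosed_compact _ _ `[s, T]%classic).
  - apply: closedI; first exact: itv_closed.
    by apply: closed_comp => // x _; exact: cf.
  - exact: segment_compact.
  - by move=> x [].
have [|sg /set_mem[/= sgT fsg] sgmin] :=
    @compact_EVT_min _ R (id : R -> R) S (ex_intro _ t St) cS.
  by apply: continuous_subspaceT => x; exact: cvg_id.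
rewrite in_itv/= in sgT; exists sg; split => //; last by left.
move=> u /andP[su usg]; rewrite leNgt; apply/negP => fu.
have [v /andP[sv vu] fv] := ivt _ su fu.
have : sg <= v.
  apply: sgmin; apply/mem_set; split => //=; rewrite in_itv/= sv.
  by rewrite (le_trans vu)// (le_trans usg)//; case/andP: sgT.
move=> sgv; suff e : sg = u by rewrite -e fsg ltxx in fu.
by apply/eqP; rewrite eq_le usg (le_trans sgv vu).
Qed.

Lemma FTC_is_derive (R : realType) (F f : R -> R) (a b : R) : a <= b ->
  (forall u, is_derive u (1 : R) F (f u)) -> continuous f ->
  (\int[lebesgue_measure]_(u in `[a, b]) (f u)%:E = (F b - F a)%:E)%E.
Proof.
rewrite le_eqVlt => /predU1P[<- _ _|ab dF cf].
  by rewrite set_itv1 integral_set1 subrr.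
have cF : continuous F by move=> u; apply/differentiable_continuous/derivable1_diffP.
rewrite (@continuous_FTC2 _ _ F)//.
- by apply: continuous_subspaceT.
- split; first by move=> x _; case: (dF x).
  + by apply: cvg_at_right_filter; exact: cF.
  + by apply: cvg_at_left_filter; exact: cF.
- by move=> x _; rewrite derive1E; case: (dF x).
Qed.

Definition generator (R : realType) (N : nat) (C : 'I_N -> R)
    (lam mu : route N -> R) (f : (act lam -> nat) -> R) (z : act lam -> nat) : R :=
  \sum_(r : act lam) (lam (val r) * (f (up z r) - f z) +
                      muX C mu (embed z) r * (f (down z r) - f z)).

Section Comparison.
Variables (R : realType) (N : nat) (C : 'I_N -> R) (lam mu : route N -> R).
Hypotheses (C_gt0 : forall i, 0 < C i) (lam_ge0 : forall r, 0 <= lam r).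
Hypothesis mu_gt0 : forall r, 0 < mu r.
Local Notation state := (act lam -> nat).

Lemma load_ge0 (x : act lam -> R) i : (forall r, 0 <= x r) -> 0 <= load x i.
Proof. by move=> x0; apply: sumr_ge0. Qed.

Lemma nu_ge0 (x : act lam -> R) r : (forall r, 0 <= x r) -> 0 <= nu C x r.
Proof.
move=> x0; rewrite /nu; case: ifPn => // xr; rewrite mulr_ge0// le_min.
by rewrite !divr_ge0 ?load_ge0// ltW.
Qed.

Lemma muX_ge0 (x : act lam -> R) r : (forall r, 0 <= x r) -> 0 <= muX C mu x r.
Proof. by move=> x0; rewrite mulr_ge0 ?nu_ge0// ltW. Qed.

Lemma embed_ge0 (z : state) r : (0 : R) <= embed z r.
Proof. exact: ler0n. Qed.
Hint Resolve embed_ge0 : core.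

Lemma sum_generator (f : state -> R) z :
  \sum_(r : act lam) (lam (val r) * f (up z r) + muX C mu (embed z) r * f (down z r))
  = generator C mu f z + qrate C mu z * f z.
Proof.
rewrite /generator /qrate mulr_suml -big_split/=; apply: eq_bigr => r _; ring.
Qed.

Variables (nrm : (act lam -> R) -> R) (T : R) (a D : act lam -> R) (c : R).
Let P k z s := Pk C mu nrm k T a D c z s.
Let inball z u := nrm (fun r => embed z r - a r - D r * u) < c.

Lemma Pk_ge0 k z s : (0 <= P k z s)%E.
Proof.
rewrite /P; elim: k z s => [|k IH] z s /=; first by rewrite lee_fin mulr_ge0// expR_ge0.
apply: adde_ge0; first by rewrite lee_fin mulr_ge0// expR_ge0.
apply: integral_ge0 => u _; apply: mule_ge0.
  by rewrite lee_fin mulr_ge0// expR_ge0.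
by apply: sume_ge0 => r _; apply: adde_ge0; apply: mule_ge0; rewrite ?IH ?lee_fin ?lam_ge0 ?muX_ge0.
Qed.

Lemma Pk_le_supersolution (g gd : state -> R -> R) :
  (forall z u, 0 <= g z u) ->
  (forall z u, is_derive u (1 : R) (g z) (gd z u)) ->
  (forall z, continuous (gd z)) ->
  (forall z, inball z T -> 1 <= g z T) ->
  (forall z u, 0 <= u <= T -> inball z u ->
    gd z u + generator C mu (g ^~ u) z <= 0) ->
  (forall z s u, 0 <= s <= u -> u <= T -> inball z s ->
    0 <= qrate C mu z * g z u - gd z u) ->
  forall k z s, 0 <= s <= T -> (P k z s <= (g z s)%:E)%E.
Proof.
move=> g0 dg cg gT ggen gs.
(* [h] stands for the jump integrand: 0 when no jump is allowed, the sum over the first jump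
   otherwise. *)
have key z s (h : R -> \bar R) : 0 <= s -> s <= T ->
    (forall u, (0 <= h u)%E) ->
    (forall u, s <= u <= T -> ~ tube nrm a D c z s u -> h u = 0%E) ->
    (forall u, s <= u <= T -> tube nrm a D c z s u -> (h u <=
       (expR (- qrate C mu z * (u - s)) * (qrate C mu z * g z u - gd z u))%:E)%E) ->
    ((expR (- qrate C mu z * (T - s)) * (`[< tube nrm a D c z s T >])%:R)%:E +
      \int[lebesgue_measure]_(u in `[s, T]) h u <= (g z s)%:E)%E.
  move=> s0 sT h0 hn hsum.
  have [zs|zs] := pselect (inball z s); last first.
    have nt u : s <= u -> ~ tube nrm a D c z s u.
      by move=> su tu; apply: zs; apply: tu; rewrite lexx.
    case: asboolP => [/(nt _ sT)//|_]; rewrite mulr0 add0e.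
    under eq_integral.
      move=> u; rewrite inE/= in_itv/= => /andP[su uT].
      rewrite hn ?su//; last exact: nt.
      over.
    by rewrite integral0 lee_fin.
  pose q := qrate C mu z.
  pose F (u : R) := - (expR (- q * (u - s)) * g z u).
  pose f (u : R) := expR (- q * (u - s)) * (q * g z u - gd z u).
  have dF u : is_derive u (1 : R) F (f u).
    have := dg z u => dgu.
    by apply: is_derive_eq; rewrite /f /GRing.scale/=; ring.
  have cf : continuous f.
    move=> u; apply: cvgM.
      apply: continuous_comp; last exact: continuous_expR.
      by apply: cvgM; [exact: cvg_cst|apply: cvgB; [exact: cvg_id|exact: cvg_cst]].
    apply: cvgB; last exact: cg.
    apply: cvgM; first exact: cvg_cst.
    by apply/differentiable_continuous/derivable1_diffP; case: (dg z u).
  have -> : g z s = expR (- q * (T - s)) * g z T + (F T - F s).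
    by rewrite /F subrr mulr0 expR0; ring.
  rewrite EFinD -(FTC_is_derive sT dF cf); apply: leeD.
    rewrite lee_fin ler_wpM2l ?expR_ge0//; case: asboolP => //= tT.
    by apply: gT; apply: tT; rewrite sT lexx.
  apply: ge0_integral_mono => u /=; rewrite in_itv/= => // uT.
  have [tu|nt] := pselect (tube nrm a D c z s u); first exact: hsum.
  rewrite hn// lee_fin mulr_ge0 ?expR_ge0//; case/andP: uT => su uT.
  by apply: (gs _ s) => //; rewrite s0.
elim=> [|k IH] z s /andP[s0 sT].
  rewrite /P/= -[X in (X <= _)%E]adde0.
  rewrite -[X in (_ + X <= _)%E](integral0 lebesgue_measure `[s, T]%classic).
  apply: (key z s (cst 0%E)) => // u /andP[su uT] tu.
  rewrite lee_fin mulr_ge0 ?expR_ge0//; apply: (gs _ s) => //; first by rewrite s0.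
  by apply: tu; rewrite lexx.
apply: key => // [u|u uT nt|u uT tu].
- apply: mule_ge0; first by rewrite lee_fin mulr_ge0// expR_ge0.
  apply: sume_ge0 => r _; apply: adde_ge0; apply: mule_ge0;
    by rewrite ?Pk_ge0 ?lee_fin ?lam_ge0 ?muX_ge0.
- by case: asboolP => // _; rewrite mulr0 mul0e.
case: asboolP => // _; rewrite mulr1 EFinM lee_pmul2l ?lte_fin ?expR_gt0//.
have uT0 : 0 <= u <= T by case/andP: uT => su ->; rewrite (le_trans s0 su).
have uball : inball z u by apply: tu; case/andP: uT => -> _; rewrite lexx.
apply: (@le_trans _ _ (\sum_(r : act lam) (lam (val r) * g (up z r) u +
    muX C mu (embed z) r * g (down z r) u)%:E)%E).
  apply: lee_sum => r _; rewrite EFinD !EFinM.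
  by apply: leeD; apply: lee_wpmul2l; rewrite ?lee_fin ?lam_ge0 ?muX_ge0//; exact: IH.
rewrite sumEFin lee_fin (sum_generator (g ^~ u)).
by have := ggen z u uT0 uball; lra.
Qed.

(* The term [A * (qb * (T - s)) ^+ k / k`!] bounds the contribution of paths
   with more than [k] jumps, which [P k] leaves out. *)
Lemma subsolution_le_Pk (f fd : state -> R -> R) (A qb : R) :
  (forall z u, 0 <= u <= T -> f z u <= A) ->
  (forall z u, is_derive u (1 : R) (f z) (fd z u)) ->
  (forall z, continuous (fd z)) ->
  (forall z, f z T <= 1) ->
  (forall z : state, qrate C mu z <= qb) -> 0 <= A ->
  (forall z u, 0 <= u <= T -> 0 <= f z u -> inball z u) ->
  (forall z u, 0 <= u <= T -> 0 <= f z u -> 0 <= fd z u + generator C mu (f ^~ u) z) ->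
  forall k z s, 0 <= s <= T ->
    ((f z s - A * ((qb * (T - s)) ^+ k / k`!%:R))%:E <= P k z s)%E.
Proof.
move=> fA df cfd fT1 qb_ge A0 fball fgen.
have q0 (z : state) : 0 <= qrate C mu z.
  by apply: sumr_ge0 => r _; rewrite addr_ge0 ?lam_ge0 ?muX_ge0.
have qb0 : 0 <= qb := le_trans (q0 (fun=> 0%N)) (qb_ge _).
pose err k s := A * ((qb * (T - s)) ^+ k / k`!%:R).
have err0 k s : s <= T -> 0 <= err k s.
  by move=> sT; rewrite !mulr_ge0 ?exprn_ge0 ?mulr_ge0 ?subr_ge0 ?invr_ge0.
(* The derivative of [err k.+1] is [- qb * err k]: the error that the induction hypothesis leaves
   after a jump is absorbed by the error of the next order. *)
have derr k u : is_derive u (1 : R) (err k.+1) (- qb * err k u).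
  have d1 : is_derive u (1 : R) (fun v => qb * (T - v)) (- qb).
    by apply: is_derive_eq; rewrite /GRing.scale/=; ring.
  have -> : err k.+1 = (A / k.+1`!%:R) *: (fun v => qb * (T - v)) ^+ k.+1.
    by apply/funext => v; rewrite /err !fctE /GRing.scale/=; ring.
  apply: is_derive_eq; rewrite /err /GRing.scale/= factS natrM; field.
  by rewrite nat1r !pnatr_eq0 -lt0n fact_gt0.
elim=> [|k IH] z s /andP[s0 sT].
  rewrite fact0 expr0 divr1 mulr1; apply: le_trans (Pk_ge0 _ _ _).
  by rewrite lee_fin subr_le0 fA// s0.
have [fs|fs] := ltP (f z s) 0.
  apply: le_trans (Pk_ge0 _ _ _).
  by rewrite lee_fin subr_le0 (le_trans (ltW fs))// err0.
have cf : continuous (f z).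
  by move=> u; apply/differentiable_continuous/derivable1_diffP; case: (df z u).
(* Past [sg] only nonnegativity of the integrand of [Pk] is used. At [sg] either the boundary term
   is nonpositive or [sg = T] and the terminal bound applies. *)
have [sg [/andP[ssg sgT] fsg fend]] : exists sg, [/\ s <= sg <= T,
    forall u, s <= u <= sg -> 0 <= f z u & f z sg <= 0 \/ sg = T].
  have [sg [h1 h2 h3]] := first_zero cf sT fs.
  by exists sg; split=> //; case: h3 => [->|]; [left|right].
have tub u : s <= u <= sg -> tube nrm a D c z s u.
  move=> /andP[su usg] t /andP[st tu]; apply: fball.
    by rewrite (le_trans s0 st) (le_trans tu)// (le_trans usg).
  by apply: fsg; rewrite st (le_trans tu).
pose q := qrate C mu z.
pose F (u : R) := - (expR (- q * (u - s)) * (f z u - err k.+1 u)).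
pose h (u : R) := expR (- q * (u - s)) * (q * (f z u - err k.+1 u) - fd z u - qb * err k u).
have dF u : is_derive u (1 : R) F (h u).
  have := df z u => dfu; have := derr k u => derru.
  by apply: is_derive_eq; rewrite /h /GRing.scale/=; ring.
have cerr k' : continuous (err k').
  move=> u; apply: cvgM; first exact: cvg_cst.
  apply: cvgM; last exact: cvg_cst.
  apply: (@continuous_comp _ _ _ (fun v => qb * (T - v)) (fun v => v ^+ k'));
    last exact: exprn_continuous.
  by apply: cvgM; [exact: cvg_cst|apply: cvgB; [exact: cvg_cst|exact: cvg_id]].
have ch : continuous h.
  move=> u; apply: cvgM.
    apply: continuous_comp; last exact: continuous_expR.
    by apply: cvgM; [exact: cvg_cst|apply: cvgB; [exact: cvg_id|exact: cvg_cst]].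
  apply: cvgB; last by apply: cvgM; [exact: cvg_cst|exact: cerr].
  apply: cvgB; last exact: cfd.
  by apply: cvgM; [exact: cvg_cst|apply: cvgB; [exact: cf|exact: cerr]].
have -> : f z s - err k.+1 s = expR (- q * (sg - s)) * (f z sg - err k.+1 sg) + (F sg - F s).
  by rewrite /F subrr mulr0 expR0; ring.
rewrite EFinD -(FTC_is_derive ssg dF ch) /P/=; apply: leeD.
  case: fend => [fle|sgTE].
    apply: (@le_trans _ _ 0%E); last by rewrite lee_fin mulr_ge0// expR_ge0.
    by rewrite lee_fin mulr_ge0_le0 ?expR_ge0// subr_le0 (le_trans fle)// err0.
  rewrite sgTE in tub *; rewrite asboolT; last by apply: tub; rewrite sT lexx.
  rewrite lee_fin ler_wpM2l ?expR_ge0// (le_trans _ (fT1 z))//.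
  by rewrite gerBl err0.
apply: integral_mono_subset => [u|u _|u] /=.
- by rewrite !in_itv/= => /andP[-> usg]; exact: le_trans usg sgT.
- apply: mule_ge0; first by rewrite lee_fin mulr_ge0// expR_ge0.
  apply: sume_ge0 => r _; apply: adde_ge0; apply: mule_ge0;
    by rewrite ?Pk_ge0 ?lee_fin ?lam_ge0 ?muX_ge0.
rewrite in_itv/= => usg; rewrite asboolT; last exact: tub.
have /andP[su usg'] := usg.
have uT : 0 <= u <= T by rewrite (le_trans s0 su) (le_trans usg').
rewrite mulr1 /h EFinM lee_pmul2l ?lte_fin ?expR_gt0//.
apply: (@le_trans _ _ (\sum_(r : act lam) (lam (val r) * (f (up z r) u - err k u) +
    muX C mu (embed z) r * (f (down z r) u - err k u))%:E)%E); last first.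
  apply: lee_sum => r _; rewrite EFinD !EFinM.
  by apply: leeD; apply: lee_wpmul2l; rewrite ?lee_fin ?lam_ge0 ?muX_ge0//; exact: IH.
rewrite sumEFin lee_fin (sum_generator (fun z => f z u - err k u)).
have -> : generator C mu (fun z => f z u - err k u) z = generator C mu (f ^~ u) z.
  by apply: eq_bigr => r _; ring.
rewrite -/q; have := fgen z u uT (fsg u usg).
have e1 : 0 <= err k u by apply: err0; case/andP: uT.
have e2 : 0 <= err k.+1 u by apply: err0; case/andP: uT.
have : q * err k u <= qb * err k u by apply: ler_wpM2r => //; exact: qb_ge.
have : 0 <= q * err k.+1 u by apply: mulr_ge0 => //; exact: q0.
by rewrite mulrBr; lra.
Qed.

End Comparison.

(** * The log-cost as a Legendre transform *)

Lemma expR_ge_tangent (R : realType) (p t : R) : expR t * (1 + p - t) <= expR p.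
Proof.
have -> : expR p = expR t * expR (p - t) by rewrite -expRD addrC subrK.
by rewrite ler_pM2l ?expR_gt0// -addrA expR_ge1Dx.
Qed.

Lemma ge_sub_div_ln (R : realType) (y : R) : 0 < y -> 1 - y^-1 <= ln y.
Proof.
move=> y0; have := @le_ln1Dx R (y^-1 - 1).
rewrite addrCA subrr addr0 lnV ?posrE// => h.
by have := h ltac:(by rewrite ltrBDl subrr invr_gt0); lra.
Qed.

Section Legendre.
Variables (R : realType) (D la m : R).
Hypotheses (la0 : 0 < la) (m0 : 0 < m).

(** The maximiser of [t * D - la * (expR t - 1) - m * (expR (- t) - 1)], that is, the root of
    [la * expR t - m * expR (- t) = D]; the maximum is [lfun D la m]. *)
Definition tilt : R := ln ((D + Num.sqrt (D ^+ 2 + 4 * la * m)) / (2 * la)).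
Let sq := Num.sqrt (D ^+ 2 + 4 * la * m).

Lemma disc_gt0 : 0 < D ^+ 2 + 4 * la * m.
Proof. by rewrite ltr_wpDl ?sqr_ge0// !mulr_gt0. Qed.

Lemma sqr_sq : sq ^+ 2 = D ^+ 2 + 4 * la * m.
Proof. by rewrite sqr_sqrtr// ltW// disc_gt0. Qed.

Lemma norm_lt_sq : `|D| < sq.
Proof.
rewrite -sqrtr_sqr ltr_sqrt ?disc_gt0// ltrDl !mulr_gt0//.
Qed.

Lemma sq_le : sq <= `|D| + la + m.
Proof.
have h : 0 <= `|D| + la + m by rewrite !addr_ge0// ltW.
rewrite -(@ler_pXn2r _ 2) ?nnegrE ?sqrtr_ge0// sqr_sq -(real_normK (num_real D)).
have := sqr_ge0 (la - m); have : 0 <= `|D| * (la + m) by rewrite mulr_ge0// addr_ge0// ltW.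
by nra.
Qed.

Lemma expR_tilt : la * expR tilt = (sq + D) / 2.
Proof.
rewrite /tilt lnK; first by rewrite -/sq; field; exact: lt0r_neq0.
rewrite posrE divr_gt0 ?mulr_gt0// -/sq.
by have := norm_lt_sq; have := ler_norm (- D); rewrite normrN; lra.
Qed.

Lemma expRN_tilt : m * expR (- tilt) = (sq - D) / 2.
Proof.
have e0 := expR_gt0 tilt.
rewrite expRN; apply: (@mulfI _ (la * expR tilt)); first by rewrite mulf_neq0 ?lt0r_neq0.
rewrite {2}expR_tilt; have := sqr_sq => h.
have -> : la * expR tilt * (m / expR tilt) = la * m by field; exact: lt0r_neq0.
by field: h.
Qed.

Lemma lfunE : lfun D la m = D * tilt + la + m - sq. Proof. by []. Qed.

Lemma lfun_at_tilt m' :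
  la * (expR tilt - 1) + m' * (expR (- tilt) - 1) - tilt * D
  = - lfun D la m + (m' - m) * (expR (- tilt) - 1).
Proof. by rewrite lfunE; have := expR_tilt; have := expRN_tilt; lra. Qed.

(* Both exponentials are minorised by tangents, the second one at the tilt that
   is optimal for [m'], which makes the linear terms in [p] cancel. *)
Lemma lfun_ge_any_tilt (m' h p : R) : 0 < m' -> 0 <= h ->
  - lfun D la m - `|m' - m| * (1 + (`|D| + la + m) / m') - (`|D| + la + m) * h
  <= la * (expR (p - h) - 1) + m' * (expR (- p - h) - 1) - p * D.
Proof.
move=> m'0 h0.
(* With this shift [m' * expR (- t')] equals [m * expR (- tilt)], so the coefficient of [p] is still
   [D]. The price, a multiple of [ln (m' / m)], is bounded below through [ln y >= 1 - 1 / y]. *)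
pose t' := tilt + ln (m' / m).
have t'E : m' * expR (- t') = m * expR (- tilt).
  rewrite /t' opprD expRD expRN (expRN (ln _)) lnK ?posrE ?divr_gt0//.
  by field; rewrite !lt0r_neq0// expR_gt0.
have b0 : 0 < m * expR (- tilt) by rewrite mulr_gt0// expR_gt0.
have a0 : 0 < la * expR tilt by rewrite mulr_gt0// expR_gt0.
have h1 : la * expR tilt * (1 + (p - h) - tilt) <= la * expR (p - h).
  by rewrite -mulrA ler_pM2l// expR_ge_tangent.
have h2 : m * expR (- tilt) * (1 + (- p - h) + t') <= m' * expR (- p - h).
  by rewrite -t'E -mulrA ler_pM2l// -[X in _ + X]opprK expR_ge_tangent.
have l1 : 1 - m / m' <= ln (m' / m).
  by have := @ge_sub_div_ln _ (m' / m) (divr_gt0 m'0 m0); rewrite invf_div.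
have ab : la * expR tilt + m * expR (- tilt) = sq by rewrite expR_tilt expRN_tilt; lra.
have l2 : - (`|m' - m| / m') <= ln (m' / m).
  apply: le_trans l1; have -> : 1 - m / m' = (m' - m) / m' by field; exact: lt0r_neq0.
  by rewrite -mulNr ler_pM2r ?invr_gt0// lerNl -normrN ler_norm.
have dm0 : 0 <= `|m' - m| / m' by rewrite divr_ge0// ltW.
have bsq : m * expR (- tilt) <= `|D| + la + m by apply: le_trans sq_le; lra.
have l3 : - ((`|D| + la + m) * (`|m' - m| / m')) <= m * expR (- tilt) * ln (m' / m).
  apply: (@le_trans _ _ (- (m * expR (- tilt) * (`|m' - m| / m')))).
    by rewrite lerN2 ler_wpM2r.
  by rewrite -mulrN ler_pM2l.
have l4 : sq * h <= (`|D| + la + m) * h by apply: ler_wpM2r => //; exact: sq_le.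
have l5 : - `|m' - m| <= m - m' by rewrite lerNl opprB ler_norm.
have -> : `|m' - m| * (1 + (`|D| + la + m) / m') =
  `|m' - m| + (`|D| + la + m) * (`|m' - m| / m') by ring.
have sum : la * expR tilt * (1 + (p - h) - tilt) + m * expR (- tilt) * (1 + (- p - h) + t')
   = sq + p * D - D * tilt - sq * h + m * expR (- tilt) * ln (m' / m).
  by rewrite /t' expR_tilt expRN_tilt; field.
by rewrite lfunE; lra.
Qed.
End Legendre.

(** * Regularity of the service rates *)

(** The inverse of one plus the sum of inverses also serves when [T] is empty and there is no
    minimum. *)
Lemma exists_lower_bound (R : realFieldType) (T : finType) (f : T -> R) :
  (forall t, 0 < f t) -> exists2 b, 0 < b & forall t, b <= f t.
Proof.
move=> f0; have S0 : 0 < 1 + \sum_t (f t)^-1.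
  by rewrite ltr_pwDl// sumr_ge0// => t _; rewrite invr_ge0 ltW.
exists (1 + \sum_t (f t)^-1)^-1; first by rewrite invr_gt0.
move=> t; rewrite invf_ple ?posrE// (bigD1 t)//= addrCA lerDl addr_ge0//.
by rewrite sumr_ge0// => u _; rewrite invr_ge0 ltW.
Qed.

Lemma minr_lip (R : realDomainType) (a b a' b' : R) :
  `|Num.min a b - Num.min a' b'| <= `|a - a'| + `|b - b'|.
Proof.
have := ler_norm (a - a'); have := ler_norm (b - b').
have := ler_norm (- (a - a')); have := ler_norm (- (b - b')); rewrite !normrN.
by move=> *; rewrite ler_norml; case: (leP a b); case: (leP a' b') => *; apply/andP; split; lra.
Qed.

Lemma ler_sumT (R : numDomainType) (T : finType) (f : T -> R) t :
  (forall u, 0 <= f u) -> f t <= \sum_u f u.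
Proof. by move=> f0; rewrite (bigD1 t)//= lerDl sumr_ge0. Qed.

Section Rates.
Variables (R : realType) (N : nat) (C : 'I_N -> R) (lam mu : route N -> R).
Hypotheses (C_gt0 : forall i, 0 < C i) (lam_ge0 : forall r, 0 <= lam r).
Hypothesis mu_gt0 : forall r, 0 < mu r.
Local Notation vec := (act lam -> R).
Local Notation fst_ r := (val (val r)).1.
Local Notation snd_ r := (val (val r)).2.

Lemma onr_fst (r : act lam) : onr (fst_ r) (val r).
Proof. by rewrite /onr eqxx. Qed.
Lemma onr_snd (r : act lam) : onr (snd_ r) (val r).
Proof. by rewrite /onr eqxx orbT. Qed.

(** With [0 / 0 = 0] the ratios absorb the case [x r = 0], and homogeneity and continuity away from
    zero load can be read off. *)
Lemma nuE (x : vec) r : (forall r, 0 <= x r) ->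
  nu C x r = Num.min (C (fst_ r) * (x r / load x (fst_ r)))
                     (C (snd_ r) * (x r / load x (snd_ r))).
Proof.
move=> x0; rewrite /nu; case: ifPn => [xr|].
  by rewrite minr_pMr ?ltW// mulrCA [X in Num.min _ X]mulrCA.
rewrite -leNgt => xr; have -> : x r = 0 by apply/le_anti; rewrite xr x0.
by rewrite !mul0r !mulr0 minxx.
Qed.

Lemma le_load (x : vec) i r : (forall r, 0 <= x r) -> onr i (val r) -> x r <= load x i.
Proof. by move=> x0 ir; rewrite /load (bigD1 r)//= lerDl sumr_ge0. Qed.

Lemma nu_le_ratio (x : vec) r i : (forall r, 0 <= x r) -> onr i (val r) ->
  nu C x r <= C i * (x r / load x i).
Proof.
move=> x0; rewrite nuE// /onr => /orP[]/eqP ->; rewrite ge_min lexx ?orbT//.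
Qed.

Lemma nu_le (x : vec) r i : (forall r, 0 <= x r) -> onr i (val r) -> nu C x r <= C i.
Proof.
move=> x0 ir; apply: le_trans (nu_le_ratio x0 ir) _.
rewrite ler_piMr ?(ltW (C_gt0 _))//; have := le_load x0 ir; have := x0 r.
have [->|xr] := eqVneq (x r) 0; first by rewrite mul0r.
by move=> x0r xl; rewrite ler_pdivrMr ?mul1r// (lt_le_trans _ xl)// lt_def xr.
Qed.

Lemma load_scale (k : R) (x : vec) i : load (fun r => k * x r) i = k * load x i.
Proof. by rewrite /load mulr_sumr. Qed.

Lemma nu_scale (k : R) (x : vec) r : 0 < k -> (forall r, 0 <= x r) ->
  nu C (fun r => k * x r) r = nu C x r.
Proof.
move=> k0 x0; have kx0 r' : 0 <= k * x r' by rewrite mulr_ge0// ltW.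
rewrite !nuE//.
by rewrite !load_scale -!mulf_div divff ?mul1r// lt0r_neq0.
Qed.

Lemma muX_le (x : vec) r : (forall r, 0 <= x r) -> muX C mu x r <= mu (val r) * C (fst_ r).
Proof. by move=> x0; rewrite ler_pM2l// nu_le ?onr_fst. Qed.

Lemma ratio_close (x y : vec) (eta m : R) i r :
  (forall r, 0 <= x r) -> (forall r, 0 <= y r) -> 0 < m ->
  (forall r, `|y r - x r| <= eta) -> #|{: act lam}|%:R * eta <= m / 2 ->
  m <= load x i -> onr i (val r) ->
  `|y r / load y i - x r / load x i| <= (1 + #|{: act lam}|%:R) * 2 / m * eta.
Proof.
move=> x0 y0 m0 yx eta_le mx ir; set n := #|_|%:R in eta_le *.
have eta0 : 0 <= eta := le_trans (normr_ge0 _) (yx r).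
have n0 : 0 <= n by rewrite ler0n.
have dl : `|load x i - load y i| <= n * eta.
  rewrite distrC /load -sumrB (le_trans (ler_norm_sum _ _ _))//.
  apply: (@le_trans _ _ (\sum_(r' : act lam) eta)); last by rewrite sumr_const -mulr_natl.
  by rewrite big_mkcond/=; apply: ler_sum => r' _; case: ifP.
have Y0 : m / 2 <= load y i by move: dl; rewrite ler_norml => /andP[? ?]; lra.
have X0 : 0 < load x i by lra.
have Yp : 0 < load y i by lra.
(* Here the load difference is multiplied only by [x r / load x i <= 1], so the error is linear in
   [eta], with a constant depending on [m] and the number of routes. *)
have -> : y r / load y i - x r / load x i =
    ((y r - x r) + x r / load x i * (load x i - load y i)) / load y i.
  by field; rewrite !lt0r_neq0.
have rat : 0 <= x r / load x i <= 1.
  by rewrite divr_ge0 ?(ltW X0)//= ler_pdivrMr// mul1r le_load.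
rewrite normrM (ger0_norm (x := (load y i)^-1)) ?invr_ge0 ?(ltW Yp)//.
apply: (@le_trans _ _ ((eta + n * eta) * (2 / m)));
  last by rewrite le_eqVlt; apply/orP; left; apply/eqP; ring.
apply: ler_pM => //; first by rewrite invr_ge0 ltW.
  apply: (le_trans (ler_normD _ _)); apply: lerD => //; rewrite normrM.
  case/andP: rat => r0 r1; rewrite (ger0_norm r0).
  by apply: le_trans dl; rewrite ler_piMl.
by rewrite -[2 / m]invrK invf_div lef_pV2// posrE divr_gt0.
Qed.

Lemma face_ge0 (L : pred (act lam)) x : face L x -> forall r, 0 <= x r.
Proof. by move=> xL r; case: (xL r) => -[]; [move/ltW|move->]. Qed.

Lemma face_eq0 (L : pred (act lam)) x r : face L x -> ~~ L r -> x r = 0.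
Proof. by move=> xL Lr; case: (xL r) => -[] //; rewrite (negbTE Lr). Qed.

Lemma supp_face (L : pred (act lam)) x : face L x -> supp x =1 L.
Proof.
move=> xL r; rewrite /supp; case: (xL r) => -[]; first by move=> -> ->.
by move=> -> /negbTE ->; rewrite ltxx.
Qed.

Lemma Lambda1_shared (L : pred (act lam)) r : Lambda1 L r ->
  exists i r', [/\ onr i (val r), onr i (val r') & L r'].
Proof.
case/andP => _ /existsP[r' /andP[Lr' /existsP[i /andP[ir ir']]]].
by exists i, r'.
Qed.

Lemma nu_face_Lambda1 (L : pred (act lam)) x r : face L x -> Lambda1 L r -> nu C x r = 0.
Proof.
by move=> xL /andP[Lr _]; rewrite /nu (face_eq0 xL Lr) ltxx.
Qed.

(** A route of [L] loads both its channels by at least [m], so both ratios are stable. A route of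
    Lambda_1 has rate 0 at [x], and the minimum is bounded by the ratio at the one channel shared
    with [L], which suffices. [eta] does not depend on [x]. *)
Lemma muX_close (L : pred (act lam)) (m e : R) : 0 < m -> 0 < e ->
  exists2 eta, 0 < eta & forall x y : vec, face L x -> (forall r, L r -> m <= x r) ->
    (forall r, 0 <= y r) -> (forall r, `|y r - x r| <= eta) ->
    forall r, L r || Lambda1 L r -> `|muX C mu y r - muX C mu x r| <= e.
Proof.
move=> m0 e0; set n : R := #|{: act lam}|%:R.
pose Cs := \sum_i C i; pose Ms := \sum_(r : act lam) mu (val r).
have Cs0 : 0 <= Cs by apply: sumr_ge0 => i _; exact: ltW.
have Ms0 : 0 <= Ms by apply: sumr_ge0 => i _; exact: ltW.
have n0 : 0 <= n by rewrite ler0n.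
pose K := (1 + n) * 2 / m.
have K0 : 0 <= K by rewrite /K divr_ge0 ?mulr_ge0 ?addr_ge0// ltW.
pose A := Ms * (2 * Cs * K) + 1.
have A0 : 0 < A.
  by apply: ltr_wpDl => //; apply: mulr_ge0 => //; apply: mulr_ge0 => //; exact: mulr_ge0.
pose eta := Num.min (m / (2 * (n + 1))) (e / A).
have nn : 0 < 2 * (n + 1) by rewrite mulr_gt0// ltr_wpDl.
exists eta; [rewrite /eta lt_min; apply/andP; split; exact: divr_gt0|].
move=> x y xL xm y0 yx r Lr; have x0 := face_ge0 xL.
have eta0 : 0 <= eta by exact: le_trans (normr_ge0 _) (yx r).
have eta_n : n * eta <= m / 2.
  apply: (@le_trans _ _ (n * (m / (2 * (n + 1))))); first by rewrite ler_wpM2l// ge_min lexx.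
  by rewrite mulrA ler_pdivrMr// mulrACA -mulrA; nra.
have Cr i : 0 <= C i <= Cs by rewrite ltW//= ler_sumT// => j; exact: ltW.
have key i r' : L r' -> onr i (val r') -> onr i (val r) ->
    `|y r / load y i - x r / load x i| <= K * eta.
  move=> Lr' ir' ir; apply: ratio_close => //.
  exact: le_trans (xm _ Lr') (le_load x0 ir').
have Ke : 0 <= K * eta by rewrite mulr_ge0.
have nuc : `|nu C y r - nu C x r| <= 2 * Cs * K * eta.
  case/orP: Lr => [Lr|L1r].
    rewrite !nuE//; apply: le_trans (minr_lip _ _ _ _) _.
    have -> : 2 * Cs * K * eta = Cs * (K * eta) + Cs * (K * eta) by ring.
    rewrite -!mulrBr !normrM.
    have CK i : onr i (val r) ->
        `|C i| * `|y r / load y i - x r / load x i| <= Cs * (K * eta).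
      move=> ir; case/andP: (Cr i) => Ci0 CiCs; apply: ler_pM => //.
        by rewrite ger0_norm.
      exact: (key _ r).
    by apply: lerD; apply: CK; rewrite ?onr_fst ?onr_snd.
  rewrite (nu_face_Lambda1 xL L1r) subr0 ger0_norm ?nu_ge0//.
  have [i [r' [ir ir' Lr']]] := Lambda1_shared L1r.
  apply: le_trans (nu_le_ratio y0 ir) _.
  have := key _ _ Lr' ir' ir; case/andP: L1r => nL _.
  rewrite (face_eq0 xL nL) mul0r subr0 => h.
  apply: (@le_trans _ _ (Cs * (K * eta))).
    apply: ler_pM; [by case/andP: (Cr i)| |by case/andP: (Cr i)|exact: le_trans (ler_norm _) h].
    by rewrite divr_ge0 ?load_ge0.
  have -> : 2 * Cs * K * eta = Cs * (K * eta) + Cs * (K * eta) by ring.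
  by rewrite lerDl mulr_ge0.
rewrite /muX -mulrBr normrM gtr0_norm//.
apply: (@le_trans _ _ (Ms * (2 * Cs * K * eta))).
  apply: ler_pM => //; first exact: ltW.
  exact: (@ler_sumT _ _ (fun r : act lam => mu (val r)) r (fun r' => ltW (mu_gt0 _))).
apply: (@le_trans _ _ (A * eta)); first by rewrite mulrA ler_wpM2r// lerDl.
by rewrite mulrC -ler_pdivlMr// ge_min lexx orbT.
Qed.

(** This uniform bound is what allows division by the rates. Loads are bounded since entries outside
    [L] vanish; [|B| + 1] keeps the bound positive for every [B]. *)
Lemma muX_face_gt (L : pred (act lam)) (m B : R) : 0 < m ->
  exists2 b, 0 < b & forall x : vec, face L x -> (forall r, L r -> m <= x r <= B) ->
    forall r, L r -> b <= muX C mu x r.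
Proof.
move=> m0; pose n : R := #|{: act lam}|%:R.
have n0 : 0 <= n by rewrite ler0n.
pose B' := (n + 1) * (`|B| + 1).
have B'0 : 0 < B' by rewrite /B' mulr_gt0// ltr_wpDl.
have [c c0 cC] := exists_lower_bound C_gt0.
have [d d0 dm] := exists_lower_bound (fun r : act lam => mu_gt0 (val r)).
exists (d * (c * (m / B'))); first by rewrite !mulr_gt0// invr_gt0.
move=> x xL xmB r Lr; have x0 := face_ge0 xL.
have rb i : onr i (val r) -> c * (m / B') <= C i * (x r / load x i).
  move=> ir; have xl := le_load x0 ir; case/andP: (xmB r Lr) => mx _.
  have l0 : 0 < load x i by apply: lt_le_trans xl; exact: lt_le_trans mx.
  apply: ler_pM => //; [exact: ltW|by rewrite divr_ge0 ?ltW|].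
  apply: ler_pM => //; [exact: ltW|by rewrite invr_ge0 ltW|].
  rewrite lef_pV2 ?posrE//.
  apply: (@le_trans _ _ (\sum_(r' : act lam) (`|B| + 1))).
    rewrite /load big_mkcond/=; apply: ler_sum => r' _; case: ifP => // _.
    case: (boolP (L r')) => [/xmB/andP[_ h]|h]; last by rewrite (face_eq0 xL h) addr_ge0.
    by rewrite (le_trans h)// (le_trans (ler_norm _))// lerDl.
  by rewrite sumr_const -mulr_natl ler_wpM2r ?addr_ge0// lerDl.
rewrite /muX; apply: ler_pM => //; first exact: ltW.
  by rewrite mulr_ge0 ?divr_ge0// ltW.
by rewrite nuE// le_min !rb ?onr_fst ?onr_snd.
Qed.

End Rates.

(** * Upper bound *)

Lemma elog_le (R : realType) (p : \bar R) (x : R) :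
  (0 <= p)%E -> (p <= (expR x)%:E)%E -> (elog p <= x%:E)%E.
Proof.
rewrite /elog; case: eqP => [_ _ _|]; first exact: leNye.
case: p => //= p p0; rewrite !lee_fin => p0' px.
rewrite -[leRHS]expRK ler_ln ?posrE ?expR_gt0// lt_def p0' andbT.
by apply/eqP => pE; apply: p0; rewrite pE.
Qed.

(** The bound by 1 excludes [+oo], which [fine] sends to 0, so that [elog] would return
    [ln 0 = 0]. *)
Lemma elog_ge (R : realType) (p : \bar R) (x : R) :
  (p <= 1)%E -> ((expR x)%:E <= p)%E -> (x%:E <= elog p)%E.
Proof.
rewrite /elog; case: p => [p _| |]; rewrite ?leye_eq// lee_fin => px.
have p0 : 0 < p := lt_le_trans (expR_gt0 _) px.
by rewrite ifF ?lee_fin ?eqe ?(gt_eqF p0)//= -[leLHS]expRK ler_ln ?posrE ?expR_gt0.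
Qed.

Lemma elog_mono (R : realType) (p q : \bar R) :
  (0 <= p)%E -> (p <= q)%E -> (q <= 1)%E -> (elog p <= elog q)%E.
Proof.
move=> p0 pq q1; have [->|pn] := eqVneq p 0%E; first by rewrite /elog eqxx leNye.
case: p => [p| |] in p0 pq pn *; rewrite ?lee_fin// in p0.
  have pp : 0 < p by rewrite lt_def p0 andbT; apply: contra_neq pn => ->.
  have e : elog p%:E = (ln p)%:E by rewrite /elog eqe gt_eqF.
  by rewrite e; apply: elog_ge; rewrite ?lnK ?posrE.
by move: pq q1; rewrite leye_eq => /eqP ->.
Qed.

Section Sums.
Variables (R : realType) (N : nat) (lam : route N -> R).
Local Notation state := (act lam -> nat).
Implicit Types (z : state) (r : act lam).

Lemma sum_up (F : act lam -> nat -> R) z r :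
  \sum_r' F r' (up z r r') = \sum_r' F r' (z r') + (F r (z r).+1 - F r (z r)).
Proof.
rewrite (bigD1 r)//= [in RHS](bigD1 r)//= {1}/up eqxx.
rewrite (eq_bigr (fun r' => F r' (z r'))) => [|r' /negbTE rr']; first by ring.
by rewrite /up rr'.
Qed.

Lemma sum_down (F : act lam -> nat -> R) z r :
  \sum_r' F r' (down z r r') = \sum_r' F r' (z r') + (F r (z r).-1 - F r (z r)).
Proof.
rewrite (bigD1 r)//= [in RHS](bigD1 r)//= {1}/Defs.down eqxx.
rewrite (eq_bigr (fun r' => F r' (z r'))) => [|r' /negbTE rr']; first by ring.
by rewrite /Defs.down rr'.
Qed.

(** Makes the truncated predecessor in [down] harmless. *)
Lemma muX_eq0 (C : 'I_N -> R) mu z r : z r = 0%N -> muX C mu (embed z) r = 0.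
Proof. by move=> zr; rewrite /muX /nu /embed zr ltxx mulr0. Qed.

End Sums.

Section Upper.
Variables (R : realType) (N : nat) (C : 'I_N -> R) (lam mu : route N -> R).
Hypotheses (C_gt0 : forall i, 0 < C i) (lam_ge0 : forall r, 0 <= lam r).
Hypothesis mu_gt0 : forall r, 0 < mu r.
Local Notation state := (act lam -> nat).
Local Notation vec := (act lam -> R).
Variable nrm : vec -> R.

(** An exponential supersolution for an arbitrary tilt [th]: [al] bounds its growth per unit time
    inside the tube, and [be] raises its terminal value to at least 1 there. *)
Lemma Pk_le_expR (T : R) (a D : vec) (c : R) (th : vec) (al be : R) :
  (forall (z : state) u, 0 <= u <= T -> nrm (fun r => embed z r - a r - D r * u) < c ->
     \sum_(r : act lam) (lam (val r) * (expR (th r) - 1) +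
        muX C mu (embed z) r * (expR (- th r) - 1) - th r * D r) <= al) ->
  (forall z : state, nrm (fun r => embed z r - a r - D r * T) < c ->
     0 <= \sum_r th r * (embed z r - a r - D r * T) + be) ->
  forall k z s, 0 <= s <= T ->
    (Pk C mu nrm k T a D c z s <=
      (expR (al * (T - s) + \sum_r th r * (embed z r - a r - D r * s) + be))%:E)%E.
Proof.
move=> Hal Hbe.
pose E (z : state) u := al * (T - u) + \sum_r th r * (embed z r - a r - D r * u) + be.
pose S := \sum_r th r * D r.
have dE z u : is_derive u (1 : R) (fun v => expR (E z v)) ((- al - S) * expR (E z u)).
  have -> : (fun v => expR (E z v)) =
      (fun v => expR ((al * T + \sum_r th r * (embed z r - a r) + be) - (al + S) * v)).
    apply/funext => v; congr expR; rewrite /E.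
    have -> : \sum_r th r * (embed z r - a r - D r * v) =
        \sum_r th r * (embed z r - a r) - S * v.
      by rewrite /S mulr_suml -sumrB; apply: eq_bigr => r _; ring.
    by ring.
  apply: is_derive_eq; rewrite /GRing.scale/=.
  have -> : E z u = (al * T + \sum_r th r * (embed z r - a r) + be) - (al + S) * u.
    rewrite /E.
    have -> : \sum_r th r * (embed z r - a r - D r * u) =
        \sum_r th r * (embed z r - a r) - S * u.
      by rewrite /S mulr_suml -sumrB; apply: eq_bigr => r _; ring.
    by ring.
  by ring.
have genE (z : state) u : generator C mu (fun z => expR (E z u)) z = expR (E z u) *
    \sum_(r : act lam) (lam (val r) * (expR (th r) - 1) +
        muX C mu (embed z) r * (expR (- th r) - 1)).
  rewrite mulr_sumr; apply: eq_bigr => r _.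
  rewrite /E (sum_up (fun r k => th r * (k%:R - a r - D r * u))) -natr1.
  have -> : al * (T - u) + (\sum_r' th r' * (embed z r' - a r' - D r' * u) +
      (th r * (embed z r + 1 - a r - D r * u) - th r * (embed z r - a r - D r * u))) + be
      = E z u + th r by rewrite /E; ring.
  rewrite expRD -/(E z u).
  have [zr|zr] := posnP (z r); first by rewrite muX_eq0// !mul0r; ring.
  rewrite (sum_down (fun r k => th r * (k%:R - a r - D r * u))) -subn1 natrB//.
  have -> : al * (T - u) + (\sum_r' th r' * (embed z r' - a r' - D r' * u) +
      (th r * (embed z r - 1 - a r - D r * u) - th r * (embed z r - a r - D r * u))) + be
      = E z u - th r by rewrite /E; ring.
  by rewrite (expRD (E z u) (- th r)); ring.
have balS (z : state) u : 0 <= u <= T ->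
    nrm (fun r => embed z r - a r - D r * u) < c ->
    \sum_(r : act lam) (lam (val r) * (expR (th r) - 1) +
        muX C mu (embed z) r * (expR (- th r) - 1)) <= al + S.
  by move=> uT zu; have := Hal z u uT zu; rewrite sumrB lerBlDr.
apply: (Pk_le_supersolution C_gt0 lam_ge0 mu_gt0 (g := fun z u => expR (E z u))
  (gd := fun z u => (- al - S) * expR (E z u))).
- by move=> z u; exact: expR_ge0.
- move=> z; have ce : continuous (fun v => expR (E z v)).
    by move=> u; apply/differentiable_continuous/derivable1_diffP; case: (dE z u).
  by move=> u; apply: cvgM; [exact: cvg_cst|exact: ce].
- by move=> z /Hbe h; rewrite -expR0 ler_expR /E subrr mulr0 add0r.
- move=> z u uT zu; rewrite genE.
  have := expR_gt0 (E z u); have := balS z u uT zu.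
  by move: (\sum_r _) => X XS e0; nra.
(* The state has not changed since time [s], when it was in the tube, so the growth hypothesis is
   applied at [s]. Adding [qrate] leaves a sum of exponentials with nonnegative weights. *)
- move=> z s u /andP[s0 su] uT zs.
  have sT : 0 <= s <= T by rewrite s0 (le_trans su).
  suff : 0 <= qrate C mu z + al + S by have := expR_gt0 (E z u); nra.
  apply: (@le_trans _ _ (qrate C mu z + \sum_(r : act lam) (lam (val r) * (expR (th r) - 1) +
        muX C mu (embed z) r * (expR (- th r) - 1)))).
    rewrite -big_split/=; apply: sumr_ge0 => r _.
    have e1 := expR_gt0 (th r); have e2 := expR_gt0 (- th r).
    have := muX_ge0 C_gt0 mu_gt0 r (embed_ge0 z); have := lam_ge0 (val r).
    move: (lam _) (muX _ _ _ _) => l x l0 x0.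
    have := mulr_ge0 l0 (ltW e1); have := mulr_ge0 x0 (ltW e2).
    by lra.
  by rewrite -addrA lerD2l; exact: balS sT zs.
Qed.

Lemma tubeProb_ge0 T (a D : vec) c (y : state) : (0 <= tubeProb C mu nrm T a D c y)%E.
Proof.
apply: le_trans (Pk_ge0 C_gt0 lam_ge0 mu_gt0 nrm T a D c 0 y 0) _.
by apply: ereal_sup_ubound; exists 0%N.
Qed.

(** [tubeProb] is a supremum of iterated integrals, so this bound too comes from comparison: the
    zero tilt gives the constant supersolution 1. *)
Lemma tubeProb_le1 T (a D : vec) c (y : state) : 0 <= T ->
  (tubeProb C mu nrm T a D c y <= 1)%E.
Proof.
move=> T0; apply: ge_ereal_sup => _ [k _ <-].
have h1 (z : state) u : 0 <= u <= T ->
    nrm (fun r => embed z r - a r - D r * u) < c ->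
    \sum_(r : act lam) (lam (val r) * (expR 0 - 1) +
      muX C mu (embed z) r * (expR (- 0) - 1) - 0 * D r) <= 0.
  move=> _ _; rewrite big1// => r _; rewrite oppr0 expR0; ring.
have h2 (z : state) : nrm (fun r => embed z r - a r - D r * T) < c ->
    0 <= \sum_r 0 * (embed z r - a r - D r * T) + 0.
  by move=> _; rewrite addr0 big1// => r _; rewrite mul0r.
have := Pk_le_expR (th := fun=> 0) h1 h2 k y (s := 0).
rewrite lexx T0 => /(_ erefl)/le_trans; apply.
rewrite mul0r addr0 add0r big1 ?expR0// => r _; by rewrite mul0r.
Qed.

(** On Lambda_1 both drift and service rate vanish, and [l(0 || lam, 0) = lam] is the cost of having
    no arrival. *)
Lemma LrateE (L : pred (act lam)) (x D : vec) : face L x -> in_span L D ->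
  Lrate C mu x D = \sum_(r : act lam)
    (if L r then lfun (D r) (lam (val r)) (muX C mu x r)
     else if Lambda1 L r then lam (val r) else 0).
Proof.
move=> xL LD; rewrite /Lrate big_mkcond/=; apply: eq_bigr => r _.
have -> : Lambda1 (supp x) r = Lambda1 L r.
  rewrite /Lambda1 (supp_face xL); congr (_ && _).
  by apply/eq_existsb => r'; rewrite (supp_face xL).
rewrite (supp_face xL); case: ifPn => [/orP[->//|L1]|]; last first.
  by rewrite negb_or => /andP[/negbTE -> /negbTE ->].
have /andP[nL _] := L1; rewrite (negbTE nL) L1.
rewrite /muX (nu_face_Lambda1 C xL L1) (LD _ nL) /lfun.
by rewrite !mulr0 expr2 !mul0r !addr0 add0r sqrtr0 subr0.
Qed.

Variable c0 : R.
Hypothesis c0_gt0 : 0 < c0.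
Hypothesis coord_le : forall (v : vec) r, `|v r| <= c0 * nrm v.

Lemma scaled_tube_close (x D : vec) (tau eta delta : R) (n : nat) (z : state) u :
  (0 < n)%N -> (forall r, `|D r| * tau <= eta / 2) -> c0 * delta <= eta / 2 ->
  0 <= u <= n%:R * tau ->
  nrm (fun r => embed z r - n%:R * x r - D r * u) < delta * n%:R ->
  forall r, `|n%:R^-1 * embed z r - x r| <= eta.
Proof.
move=> n0 Dtau cd /andP[u0 uT] zu r.
have n0' : 0 < n%:R :> R by rewrite ltr0n.
have h1 : `|embed z r - n%:R * x r - D r * u| <= eta / 2 * n%:R.
  apply: le_trans (coord_le (fun r => embed z r - n%:R * x r - D r * u) r) _.
  apply: (@le_trans _ _ (c0 * delta * n%:R)); last by rewrite ler_pM2r.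
  by rewrite -mulrA ler_pM2l// ltW.
have h2 : `|D r * u| <= eta / 2 * n%:R.
  rewrite normrM (ger0_norm u0); apply: (@le_trans _ _ (`|D r| * (n%:R * tau))).
    exact: ler_wpM2l.
  by rewrite mulrCA mulrC ler_pM2r.
have -> : n%:R^-1 * embed z r - x r =
    (embed z r - n%:R * x r - D r * u + D r * u) / n%:R.
  by field; exact: lt0r_neq0.
rewrite normrM (gtr0_norm (x := n%:R^-1)) ?invr_gt0// ler_pdivrMr//.
apply: le_trans (ler_normD _ _) _.
have -> : eta * n%:R = eta / 2 * n%:R + eta / 2 * n%:R by field.
exact: lerD.
Qed.

Lemma muX_scaled (n : nat) (z : state) r : (0 < n)%N ->
  muX C mu (embed z) r = muX C mu (fun r => n%:R^-1 * embed z r) r.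
Proof.
by move=> n0; rewrite /muX nu_scale// ?invr_gt0 ?ltr0n.
Qed.

Lemma exists_tau (D : vec) (eta : R) : 0 < eta ->
  exists2 tau0, 0 < tau0 & forall tau, 0 <= tau <= tau0 -> forall r, `|D r| * tau <= eta / 2.
Proof.
move=> eta0; pose S := 1 + \sum_r `|D r|.
have S0 : 0 < S by rewrite /S ltr_pwDl// sumr_ge0.
exists (eta / 2 / S); first by rewrite !divr_gt0.
move=> tau /andP[t0 tS] r; apply: (@le_trans _ _ (S * (eta / 2 / S))).
  apply: ler_pM => //; rewrite /S; apply: ler_wpDl => //.
  exact: (@ler_sumT _ _ (fun r => `|D r|)).
by rewrite mulrC divfK// lt0r_neq0.
Qed.

(** Controls, uniformly in [x], the coefficient of the rate error in [lfun_at_tilt]: by [expRN_tilt]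
    it is a bounded quantity divided by a rate that is bounded below on the face. *)
Lemma tilt_bound (L : pred (act lam)) (D : vec) (m B : R) : 0 < m ->
  exists2 E, 0 < E & forall x : vec, face L x -> (forall r, L r -> m <= x r <= B) ->
    forall r, L r -> expR (- tilt (D r) (lam (val r)) (muX C mu x r)) <= E.
Proof.
move=> m0; have [b b0 bx] := muX_face_gt C_gt0 mu_gt0 L B m0.
pose F r := `|D r| + lam (val r) + mu (val r) * C (val (val r)).1.
have F0 (r : act lam) : 0 <= F r by rewrite /F !addr_ge0// mulr_ge0// ltW.
exists ((1 + \sum_r F r) / b); first by rewrite divr_gt0// ltr_pwDl// sumr_ge0.
move=> x xL xmB r Lr; have bm := bx x xL xmB r Lr.
have x0 := face_ge0 xL.
have l0 : 0 < lam (val r) := valP r.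
have m0' := lt_le_trans b0 bm.
have e := expRN_tilt (D r) l0 m0'.
have h : muX C mu x r * expR (- tilt (D r) (lam (val r)) (muX C mu x r)) <= 1 + \sum_r F r.
  rewrite e; have := sq_le (D r) l0 m0'; have := ler_norm (- D r); rewrite normrN.
  have := @ler_sumT _ _ F r F0; have := muX_le C_gt0 mu_gt0 r x0.
  rewrite {1}/F.
  have := normr_ge0 (D r); have := mulr_gt0 (mu_gt0 (val r)) (C_gt0 (val (val r)).1); lra.
rewrite ler_pdivlMr// mulrC; apply: le_trans h.
by rewrite ler_wpM2r// expR_ge0.
Qed.

(** [tau0] is chosen before [x], which gives uniformity, whereas [delta0] may depend on [x] through
    the tilt. The start radius is the tube radius, so every smaller one is covered. *)
Lemma logP_upper (L : pred (act lam)) (D : vec) (m B e : R) :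
  in_span L D -> 0 < m -> 0 < e ->
  exists2 tau0, 0 < tau0 & forall tau, 0 < tau < tau0 ->
    forall x : vec, face L x -> (forall r, L r -> m <= x r <= B) ->
    exists2 delta0, 0 < delta0 & forall delta, 0 < delta < delta0 ->
      forall n (y : state), (0 < n)%N -> startset nrm x delta n y ->
      (logP C mu nrm x D tau delta n y <= (n%:R * tau * (- Lrate C mu x D + e))%:E)%E.
Proof.
move=> LD m0 e0.
have [E E0 HE] := tilt_bound L D B m0.
pose nR : R := #|{: act lam}|%:R.
have nR0 : 0 <= nR by rewrite ler0n.
(* Each route may lose [e'], in total at most [e / 2]; the other half of [e] pays for the linear
   terms at both ends of the path. *)
pose e' := e / (2 * (nR + 1)).
have e'0 : 0 < e' by rewrite divr_gt0// mulr_gt0// ltr_wpDl.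
pose Ls := \sum_(r : act lam) lam (val r).
have Ls0 : 0 <= Ls by apply: sumr_ge0 => r _; exact: lam_ge0.
(* [ka] is the value of [expR (th r)] on Lambda_1, so small that arrivals contribute at most
   [- lam + e' / 2]. Then [e1] is made so small that services, amplified by [1 / ka], add at most
   [e' / 2]. *)
pose ka := e' / (2 * (Ls + 1)).
have ka0 : 0 < ka by rewrite divr_gt0// mulr_gt0// ltr_wpDl.
have lamka (r : act lam) : lam (val r) * ka <= e' / 2.
  apply: (@le_trans _ _ ((Ls + 1) * ka)).
    rewrite ler_pM2r//.
    have := @ler_sumT _ _ (fun r : act lam => lam (val r)) r (fun r' => lam_ge0 _).
    by rewrite -/Ls; lra.
  by rewrite le_eqVlt; apply/orP; left; apply/eqP; rewrite /ka; field; rewrite lt0r_neq0// ltr_wpDl.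
pose e1 := Num.min (e' / 2 * ka) (e' / (E + 1)).
have e10 : 0 < e1 by rewrite /e1 lt_min; apply/andP; split;
    [apply: mulr_gt0 => //; exact: divr_gt0|apply: divr_gt0 => //; exact: addr_gt0].
have [eta eta0 Heta] := muX_close C_gt0 mu_gt0 L m0 e10.
have [tau0 tau00 Htau] := exists_tau D eta0.
exists tau0 => // tau /andP[t0 tt] x xL xmB.
pose th r := if L r then tilt (D r) (lam (val r)) (muX C mu x r)
  else if Lambda1 L r then ln ka else 0.
pose S := 1 + \sum_r `|th r|.
have S0 : 0 < S by rewrite /S ltr_pwDl// sumr_ge0.
(* The first bound keeps the scaled path within [eta] of [x]; the second gives
   [2 * be <= n * tau * (e / 2)]. *)
exists (Num.min (eta / 2 / c0) (tau * e / (4 * S * c0))).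
  rewrite lt_min; apply/andP; split; first by rewrite !divr_gt0.
  by apply: divr_gt0; rewrite !mulr_gt0.
move=> delta /andP[d0]; rewrite lt_min => /andP[/ltW d1 /ltW d2] n y n0 ysS.
have n0' : 0 < n%:R :> R by rewrite ltr0n.
have cd : c0 * delta <= eta / 2 by rewrite mulrC -ler_pdivlMr.
pose be := S * c0 * delta * n%:R.
have lin (v : vec) : nrm v < delta * n%:R -> `|\sum_r th r * v r| <= be.
  move=> vd; apply: le_trans (ler_norm_sum _ _ _) _.
  apply: (@le_trans _ _ (\sum_r `|th r| * (c0 * (delta * n%:R)))).
    apply: ler_sum => r _; rewrite normrM; apply: ler_wpM2l => //.
    by apply: le_trans (coord_le v r) _; rewrite ler_pM2l// ltW.
  rewrite -mulr_suml /be -!mulrA ler_wpM2r//; first by rewrite !mulr_ge0// ltW.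
  by rewrite /S lerDr.
have x0 := face_ge0 xL.
have bal (z : state) u : 0 <= u <= n%:R * tau ->
    nrm (fun r => embed z r - n%:R * x r - D r * u) < delta * n%:R ->
    \sum_(r : act lam) (lam (val r) * (expR (th r) - 1) +
      muX C mu (embed z) r * (expR (- th r) - 1) - th r * D r)
    <= - Lrate C mu x D + e / 2.
  move=> uT zu.
  have close := scaled_tube_close n0 (Htau tau ltac:(by rewrite (ltW t0) (ltW tt))) cd uT zu.
  have ez0 r : 0 <= n%:R^-1 * embed z r :> R by rewrite mulr_ge0 ?invr_ge0 ?embed_ge0// ltW.
  have mclose := Heta _ _ xL (fun r Lr => proj1 (andP (xmB r Lr))) ez0 close.
  apply: (@le_trans _ _ (- Lrate C mu x D + \sum_(r : act lam) e')); last first.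
    rewrite lerD2l sumr_const -[_ *+ _]mulr_natl -/nR /e'.
    rewrite mulrA ler_pdivrMr; last by rewrite mulr_gt0// ltr_wpDl.
    by nra.
  rewrite (LrateE xL LD) -sumrN -big_split/=; apply: ler_sum => r _.
  rewrite (muX_scaled z r n0) /th.
  have := mclose r; have := muX_ge0 C_gt0 mu_gt0 r ez0.
  move: (muX C mu (fun r => n%:R^-1 * embed z r) r) => m' m'0 hm.
  case: ifPn => [Lr|nL].
    move: hm; rewrite Lr => /(_ isT) hm.
    have mx0 : 0 < muX C mu x r.
      by have [b b0 bx] := muX_face_gt C_gt0 mu_gt0 L B m0; exact: lt_le_trans (bx _ xL xmB _ Lr).
    rewrite (lfun_at_tilt (D r) (valP r : 0 < lam (val r)) mx0) lerD2l.
    have := HE x xL xmB r Lr; move: (expR _) (expR_gt0 (- tilt (D r) (lam (val r)) (muX C mu x r)))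
      => X X0 XE.
    apply: le_trans (ler_norm _) _; rewrite normrM.
    apply: (@le_trans _ _ (e1 * (E + 1))).
      apply: ler_pM => //; rewrite ler_norml; apply/andP; split; lra.
    rewrite -ler_pdivlMr ?addr_gt0//; by rewrite /e1 ge_min lexx orbT.
  rewrite (LD _ nL); case: ifPn => [L1|nL1]; last first.
    by rewrite oppr0 expR0 subrr !mulr0 add0r subr0 add0r ltW.
  move: hm; rewrite L1 orbT => /(_ isT).
  have -> : muX C mu x r = 0 by rewrite /muX (nu_face_Lambda1 C xL L1) mulr0.
  rewrite subr0 => hm; rewrite expRN lnK ?posrE//.
  have h1 : m' / ka <= e' / 2.
    rewrite ler_pdivrMr//; apply: le_trans (le_trans (ler_norm _) hm) _.
    by rewrite /e1 ge_min lexx.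
  by have := lamka r; lra.
have sup : (tubeProb C mu nrm (n%:R * tau) (fun r => (n%:R * x r)%R) D (delta * n%:R) y
    <= (expR ((- Lrate C mu x D + e / 2) * (n%:R * tau) + 2 * be))%:E)%E.
  apply: ge_ereal_sup => _ [k _ <-].
  have T0 : 0 <= n%:R * tau by rewrite mulr_ge0// ltW.
  have h2 (z : state) : nrm (fun r => embed z r - n%:R * x r - D r * (n%:R * tau)) < delta * n%:R ->
      0 <= \sum_r th r * (embed z r - n%:R * x r - D r * (n%:R * tau)) + be.
    by move=> /lin; rewrite ler_norml => /andP[+ _]; rewrite lerNl -subr_ge0 opprK addrC.
  have := Pk_le_expR bal h2 k y (s := 0); rewrite lexx T0 => /(_ isT)/le_trans; apply.
  have -> : 2 * be = be + be by ring.
  rewrite lee_fin ler_expR subr0 addrA lerD2r lerD2l.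
  apply: le_trans (ler_norm _) _; apply: lin.
  move: ysS; rewrite /startset/=.
  by congr (nrm _ < _); apply/funext => r; rewrite mulr0 subr0.
apply: elog_le; first exact: tubeProb_ge0.
apply: le_trans sup _; rewrite lee_fin ler_expR.
have : 2 * be <= n%:R * tau * (e / 2).
  have : delta * (4 * S * c0) <= tau * e by rewrite -ler_pdivlMr ?mulr_gt0.
  by rewrite /be; nra.
by lra.
Qed.
End Upper.

(** * Stability of the routes of Lambda_2 *)

Section Stability.
Variables (R : realType) (N : nat) (C : 'I_N -> R) (lam mu : route N -> R).
Hypotheses (C_gt0 : forall i, 0 < C i) (lam_ge0 : forall r, 0 <= lam r).
Hypothesis mu_gt0 : forall r, 0 < mu r.
Hypothesis erg : ergodic C lam mu.
Local Notation vec := (act lam -> R).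

Definition rho (r : act lam) : R := lam (val r) / mu (val r).

Lemma rho_gt0 r : 0 < rho r.
Proof. by rewrite divr_gt0//; exact: (valP r). Qed.

(** The factor [s < 1] is the strict gain in serving the fullest routes; the margin [g] leaves room
    for the few customers on Lambda_1 routes that share a channel with them. *)
Lemma ergodic_slack : exists s g : R, [/\ 0 < s < 1, 0 < g &
  forall i, \sum_(r : act lam | onr i (val r)) (rho r + g) <= s * C i].
Proof.
have [b b0 bC] := @exists_lower_bound R _ (fun i => C i -
  \sum_(r : act lam | onr i (val r)) rho r) (fun i => ltac:(by rewrite subr_gt0; exact: erg)).
pose Cs := \sum_i C i; pose n : R := #|{: act lam}|%:R.
have Cs0 : 0 <= Cs by apply: sumr_ge0 => i _; exact: ltW.
have n0 : 0 <= n by rewrite ler0n.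
pose t := Num.min (1 / 2) (b / (2 * (Cs + 1))).
have C1 : 0 < 2 * (Cs + 1) by rewrite mulr_gt0// ltr_wpDl.
have n1 : 0 < 2 * (n + 1) by rewrite mulr_gt0// ltr_wpDl.
have t0 : 0 < t by rewrite /t lt_min divr_gt0// divr_gt0.
have t1 : t <= 1 / 2 by rewrite /t ge_min lexx.
exists (1 - t), (b / (2 * (n + 1))); split; [apply/andP; split; lra|exact: divr_gt0|].
move=> i; have := bC i.
rewrite big_split/= => bi.
have h1 : \sum_(r : act lam | onr i (val r)) (b / (2 * (n + 1))) <= b / 2.
  apply: (@le_trans _ _ (\sum_(r : act lam) (b / (2 * (n + 1))))).
    by rewrite big_mkcond/=; apply: ler_sum => r _; case: ifP => // _; rewrite ltW// divr_gt0.
  rewrite sumr_const -[_ *+ _]mulr_natl -/n mulrA ler_pdivrMr//; nra.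
have h2 : t * C i <= b / 2.
  apply: (@le_trans _ _ (b / (2 * (Cs + 1)) * Cs)).
    apply: ler_pM; [exact: ltW|exact: ltW|by rewrite /t ge_min lexx orbT|].
    by apply: ler_sumT => j; exact: ltW.
  by rewrite mulrAC ler_pdivrMr//; nra.
by rewrite mulrBl mul1r; lra.
Qed.

(* For large [q] the sum is dominated by the routes with the largest
   [y r / rho r], and these are served faster than their arrival rate. *)
Lemma stability (L : pred (act lam)) : exists q g, 0 < g /\
  forall (y : vec) (e : R), (forall r, 0 <= y r) -> 0 < e ->
    (forall r, Lambda1 L r -> y r <= g * e) ->
    \sum_(r | ~~ L r && ~~ Lambda1 L r) (y r / rho r) ^+ q.+1 * (rho r - nu C y r)
      <= (\sum_r rho r) * e ^+ q.+1.
Proof.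
have [s [g [/andP[s0 s1] g0 sg]]] := ergodic_slack.
have [rm rm0 rmP] := exists_lower_bound rho_gt0.
pose P := \sum_r rho r.
have P0 : 0 <= P by apply: sumr_ge0 => r _; exact: (ltW (rho_gt0 r)).
have t0 : 0 < rm * (s^-1 - 1) by rewrite mulr_gt0// subr_gt0 invf_gt1.
(* With this [q] the gain [rm * (s^-1 - 1) * M ^+ q] from the route with the largest ratio [M]
   outweighs all the others, which contribute at most [P * (s * M) ^+ q]. *)
have [q' Hq'] : exists q, s ^+ q.+1 * P <= rm * (s^-1 - 1).
  have : s ^+ n @[n --> \oo] --> (0 : R) by apply: cvg_expr; rewrite gtr0_norm.
  move=> /cvgrPdist_lt/(_ (rm * (s^-1 - 1) / (P + 1))).
  case; first by rewrite divr_gt0// ltr_wpDl.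
  move=> q _ /(_ q.+1 (leqnSn q)); rewrite sub0r normrN ger0_norm ?exprn_ge0 ?(ltW s0)// => h.
  exists q; apply: (@le_trans _ _ (s ^+ q.+1 * (P + 1))).
    by rewrite ler_wpM2l ?exprn_ge0 ?(ltW s0)// lerDl.
  by rewrite -ler_pdivlMr ?ltr_wpDl// ltW.
exists q', g; split => // y e y0 e0 yg; move: Hq'; set q := q'.+1 => Hq.
pose L2 r := ~~ L r && ~~ Lambda1 L r.
pose u r := y r / rho r.
have u0 r : 0 <= u r by rewrite divr_ge0// ltW// rho_gt0.
have uq r : 0 <= u r ^+ q by rewrite exprn_ge0.
have yu r : y r = rho r * u r by rewrite /u mulrC divfK// lt0r_neq0// rho_gt0.
(* If no ratio exceeds [e], dropping the service terms gives the bound. Otherwise the sum is even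
   nonpositive. *)
have [/existsP[r1 /andP[L2r1 ur1]]|/existsPn ule] :=
  boolP [exists r, L2 r && (e < u r)]; last first.
  rewrite mulr_suml big_mkcond/=; apply: ler_sum => r _; case: ifPn => [L2r|_].
    have ue : u r <= e by have := ule r; rewrite /L2 L2r/= -leNgt.
    apply: (@le_trans _ _ (e ^+ q * rho r)); last by rewrite mulrC.
    apply: (@le_trans _ _ (u r ^+ q * rho r)).
      by apply: ler_wpM2l; [exact: uq|rewrite gerBl nu_ge0].
    by rewrite ler_wpM2r ?(ltW (rho_gt0 r))// lerXn2r ?nnegrE// ltW.
  by rewrite mulr_ge0 ?exprn_ge0 ?(ltW e0)// ltW// rho_gt0.
case: (@Order.TotalTheory.arg_maxP _ R _ r1 L2 u L2r1) => r0 L2r0 umax.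
pose M := u r0.
have M0 : 0 < M by apply: lt_le_trans (umax _ L2r1); exact: lt_trans ur1.
have eM : e <= M by apply: le_trans (umax _ L2r1); exact: ltW.
have sM0 : 0 < s * M by rewrite mulr_gt0.
(* No route of [L] uses a channel of a Lambda_2 route. The routes there hold at most [rho * M] on
   Lambda_2 and [g * e <= g * M] on Lambda_1, so the slack applies. *)
have loadM r i : L2 r -> onr i (val r) -> load y i <= s * M * C i.
  move=> /andP[nL nL1] ir.
  have nLs r' : onr i (val r') -> ~~ L r'.
    move=> ir'; apply/negP => Lr'; move/negP: nL1; apply; apply/andP; split => //.
    by apply/existsP; exists r'; rewrite Lr'/=; apply/existsP; exists i; rewrite ir.
  rewrite mulrAC; apply: (@le_trans _ _ (\sum_(r' : act lam | onr i (val r')) (rho r' + g) * M));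
    last first.
    by rewrite -mulr_suml ler_wpM2r ?(ltW M0).
  apply: ler_sum => r' /nLs nLr'; rewrite mulrDl.
  case: (boolP (Lambda1 L r')) => [L1|nL1'].
    apply: le_trans (yg _ L1) _; rewrite -[leLHS]add0r; apply: lerD;
      last by rewrite ler_wpM2l// ltW.
    by rewrite mulr_ge0// ltW// rho_gt0.
  rewrite yu -[leLHS]addr0; apply: lerD; last by rewrite ltW// mulr_gt0.
  rewrite ler_wpM2l//; [by rewrite ltW// rho_gt0|].
  by apply: umax; rewrite /L2 nLr' nL1'.
have nuM r : L2 r -> y r / (s * M) <= nu C y r.
  move=> L2r; have h i : onr i (val r) -> y r / (s * M) <= C i * (y r / load y i).
    move=> ir; have := loadM r i L2r ir; have := le_load y0 ir.
    have [->|yr] := eqVneq (y r) 0; first by rewrite !mul0r mulr0.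
    move=> yl lM; have yp : 0 < y r by rewrite lt_def yr y0.
    have lp : 0 < load y i := lt_le_trans yp yl.
    have -> : C i * (y r / load y i) = y r * (C i / load y i) by ring.
    by rewrite ler_pM2l// ler_pdivlMr// ler_pdivrMl.
  by rewrite nuE// le_min !h ?onr_fst ?onr_snd.
have termM r : L2 r -> u r ^+ q * (rho r - nu C y r) <= rho r * u r ^+ q * (1 - u r / (s * M)).
  move=> L2r; have -> : rho r * u r ^+ q * (1 - u r / (s * M)) =
    u r ^+ q * (rho r - y r / (s * M)) by rewrite (yu r); ring.
  by apply: ler_wpM2l; [exact: uq|rewrite lerD2l lerN2 nuM].
(* The factor [1 - u r / (s * M)] is positive only for ratios below [s * M]. *)
have term2 r : L2 r -> u r ^+ q * (rho r - nu C y r) <= rho r * (s * M) ^+ q.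
  move=> L2r; apply: le_trans (termM r L2r) _; rewrite -mulrA ler_wpM2l ?(ltW (rho_gt0 r))//.
  have [us|us] := leP (u r) (s * M).
    apply: (@le_trans _ _ (u r ^+ q)); last by rewrite lerXn2r// ?nnegrE// ltW.
    by apply: ler_piMr; [exact: uq|rewrite gerBl divr_ge0// ltW].
  apply: (@le_trans _ _ 0); last by rewrite exprn_ge0// ltW.
  by rewrite mulr_ge0_le0 ?exprn_ge0// subr_le0 ler_pdivlMr// mul1r ltW.
rewrite (bigD1 r0)//=; apply: (@le_trans _ _ 0); last by rewrite mulr_ge0// exprn_ge0// ltW.
have h0 : u r0 ^+ q * (rho r0 - nu C y r0) <= - (rm * (s^-1 - 1)) * M ^+ q.
  apply: le_trans (termM r0 L2r0) _.
  have -> : 1 - u r0 / (s * M) = - (s^-1 - 1) by rewrite -/M; field; rewrite !lt0r_neq0.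
  have w0 : 0 <= (s^-1 - 1) * M ^+ q.
    by rewrite mulr_ge0 ?exprn_ge0 ?(ltW M0)// subr_ge0 ltW// invf_gt1.
  have := ler_wpM2r w0 (rmP r0); rewrite -/M; lra.
have h1 : \sum_(r | ~~ L r && ~~ Lambda1 L r && (r != r0)) u r ^+ q * (rho r - nu C y r)
    <= s ^+ q * P * M ^+ q.
  apply: (@le_trans _ _ (\sum_r rho r * (s * M) ^+ q)).
    rewrite big_mkcond/=; apply: ler_sum => r _; case: ifPn => [/andP[L2r _]|_].
      exact: term2.
    by rewrite mulr_ge0 ?exprn_ge0 ?(ltW sM0)// ltW// rho_gt0.
  by rewrite -mulr_suml -/P exprMn; rewrite le_eqVlt; apply/orP; left; apply/eqP; ring.
have Mq : 0 <= M ^+ q by rewrite exprn_ge0// ltW.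
have : s ^+ q * P * M ^+ q <= rm * (s^-1 - 1) * M ^+ q by rewrite ler_wpM2r.
by rewrite mulNr in h0; lra.
Qed.

End Stability.

(** * Confining potential *)

Lemma exprDB_le (R : realDomainType) (v h : R) q : 0 <= v -> 0 <= h ->
  (v + h) ^+ q.+1 - v ^+ q.+1 <= q.+1%:R * h * (v + h) ^+ q.
Proof.
move=> v0 h0; elim: q => [|q IH]; first by rewrite !expr1 expr0; lra.
have vh0 : 0 <= v + h by rewrite addr_ge0.
have e1 : v ^+ q.+1 <= (v + h) ^+ q.+1 by rewrite lerXn2r// ?nnegrE// lerDl.
have e2 := ler_wpM2l vh0 IH; have e3 := ler_wpM2l h0 e1.
rewrite -[q.+2%:R]natr1 (exprS _ q.+1) (exprS v q.+1).
have -> : (q.+1%:R + 1) * h * (v + h) ^+ q.+1 =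
  (v + h) * (q.+1%:R * h * (v + h) ^+ q) + h * (v + h) ^+ q.+1 by rewrite exprS; ring.
by lra.
Qed.

(** [w] times the sum is a right Riemann sum of the increasing function [v ^+ q] on [[0, k * w]],
    hence at least its integral. It turns a bound on the potential into one on [z r]. *)
Lemma sum_expr_ge (R : realFieldType) (w : R) q k : 0 <= w ->
  (k%:R * w) ^+ q.+1 <= q.+1%:R * w * \sum_(j < k) (j.+1%:R * w) ^+ q.
Proof.
move=> w0; elim: k => [|k IH]; first by rewrite big_ord0 mulr0 mul0r expr0n.
rewrite big_ord_recr/= mulrDr -[k.+1%:R]natr1 mulrDl mul1r.
have := @exprDB_le _ (k%:R * w) w q (mulr_ge0 (ler0n _ _) w0) w0.
by lra.
Qed.

Lemma sum_expr_le (R : realFieldType) (w : R) q k : 0 <= w -> k%:R * w <= 1 ->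
  \sum_(j < k) (j.+1%:R * w) ^+ q <= k%:R.
Proof.
move=> w0 kw; apply: (@le_trans _ _ (\sum_(j < k) 1)); last by rewrite sumr_const card_ord.
apply: ler_sum => j _; apply: exprn_ile1; first by rewrite mulr_ge0.
by apply: le_trans kw; rewrite ler_wpM2r// ler_nat.
Qed.

Section Lower.
Variables (R : realType) (N : nat) (C : 'I_N -> R) (lam mu : route N -> R).
Hypotheses (C_gt0 : forall i, 0 < C i) (lam_ge0 : forall r, 0 <= lam r).
Hypothesis mu_gt0 : forall r, 0 < mu r.
Local Notation state := (act lam -> nat).
Local Notation vec := (act lam -> R).
Variable nrm : vec -> R.

(** Capacities bound the service rates, so the total jump rate is bounded over all states; this is
    what makes the truncation in the number of jumps negligible. *)
Lemma qrate_le (z : state) :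
  qrate C mu z <= \sum_(r : act lam) (lam (val r) + mu (val r) * C (val (val r)).1).
Proof.
by apply: ler_sum => r _; rewrite lerD2l muX_le// => r'; exact: embed_ge0.
Qed.

(** The truncation error is [A] times a term of the exponential series of [qb * T], so it vanishes
    as more jumps are allowed. *)
Lemma subsolution_le_tubeProb (T : R) (a D : vec) (c A : R) (f fd : state -> R -> R) :
  0 <= T -> 0 <= A ->
  (forall z u, 0 <= u <= T -> f z u <= A) ->
  (forall z u, is_derive u (1 : R) (f z) (fd z u)) ->
  (forall z, continuous (fd z)) ->
  (forall z, f z T <= 1) ->
  (forall z u, 0 <= u <= T -> 0 <= f z u -> nrm (fun r => embed z r - a r - D r * u) < c) ->
  (forall z u, 0 <= u <= T -> 0 <= f z u -> 0 <= fd z u + generator C mu (f ^~ u) z) ->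
  forall z, ((f z 0)%:E <= tubeProb C mu nrm T a D c z)%E.
Proof.
move=> T0 A0 fA df cfd fT fball fgen z.
set qb := \sum_(r : act lam) (lam (val r) + mu (val r) * C (val (val r)).1).
have key k : ((f z 0 - A * ((qb * T) ^+ k / k`!%:R))%:E <= tubeProb C mu nrm T a D c z)%E.
  have := subsolution_le_Pk C_gt0 lam_ge0 mu_gt0 fA df cfd fT qrate_le A0 fball fgen k z (s := 0).
  rewrite lexx T0 subr0 => /(_ isT)/le_trans; apply.
  by apply: ereal_sup_ubound; exists k.
have p0 := tubeProb_ge0 C_gt0 lam_ge0 mu_gt0 nrm T a D c z.
have p1 := tubeProb_le1 C_gt0 lam_ge0 mu_gt0 nrm a D c z T0.
move: (tubeProb _ _ _ _ _ _ _ _) p0 p1 key => [p| |]// _ _ key.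
rewrite lee_fin; apply/ler_addgt0Pr => e e0.
have : A * exp_coeff (qb * T) k @[k --> \oo] --> A * 0.
  by apply: cvgM; [exact: cvg_cst|exact: cvg_exp_coeff].
rewrite mulr0 => /cvgrPdist_lt/(_ e e0)[k _ /(_ k (leqnn k))].
rewrite sub0r normrN => /(le_lt_trans (ler_norm _)) ke.
by have := key k; rewrite lee_fin; rewrite /exp_coeff/= in ke; lra.
Qed.

Section Potential.
Variables (L : pred (act lam)) (x D : vec) (n q : nat) (k1 k2 T c b : R).
Hypotheses (n_gt0 : (0 < n)%N) (k1_ge0 : 0 <= k1) (k2_ge0 : 0 <= k2).
Let L01 r := L r || Lambda1 L r.
Let w (r : act lam) : R := (n%:R * rho mu r)^-1.

(** Outside [L01] the increments are prescribed: the step from [j] to [j.+1] costs a pure power of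
    [j.+1 / (n * rho)]. Dividing by [mu] turns [lam] into [rho] and [muX] into [nu], the form in
    which [stability] applies. *)
Definition phi (r : act lam) (k : nat) (u : R) : R :=
  if L01 r then k1 / (2 * n%:R) * (k%:R - n%:R * x r - D r * u) ^+ 2
  else k2 / mu (val r) * \sum_(j < k) (j.+1%:R * w r) ^+ q.+1.

Definition expot (z : state) (u : R) : R := - c * (T - u) - \sum_r phi r (z r) u.

Definition dexpot (z : state) (u : R) : R := c +
  \sum_r (if L01 r then k1 / n%:R * (embed z r - n%:R * x r - D r * u) * D r else 0).

Definition subsol (z : state) (u : R) : R := expR (expot z u) - b.

Lemma w_gt0 r : 0 < w r.
Proof. by rewrite invr_gt0 mulr_gt0 ?ltr0n// rho_gt0. Qed.

Lemma phi_ge0 r k u : 0 <= phi r k u.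
Proof.
rewrite /phi; case: ifP => _.
  by rewrite mulr_ge0 ?sqr_ge0// divr_ge0// mulr_ge0.
rewrite mulr_ge0 ?divr_ge0 ?(ltW (mu_gt0 _))//.
by apply: sumr_ge0 => j _; rewrite exprn_ge0// mulr_ge0// ltW// w_gt0.
Qed.

(** For a frozen state the exponent is quadratic in time; differentiability and continuity are read
    off this normal form. *)
Lemma expot_quad z : exists a0 a1 a2, (forall u, expot z u = a0 + a1 * u + a2 * (u * u)) /\
  (forall u, dexpot z u = a1 + 2 * a2 * u).
Proof.
have n0 : n%:R != 0 :> R by rewrite pnatr_eq0 -lt0n.
pose K := k1 / (2 * n%:R).
pose v r := embed z r - n%:R * x r.
pose A0 r := if L01 r then K * v r ^+ 2 else phi r (z r) 0.
pose A1 r := if L01 r then - (K * 2 * v r * D r) else 0.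
pose A2 r := if L01 r then K * D r ^+ 2 else 0.
exists (- c * T - \sum_r A0 r), (c - \sum_r A1 r), (- \sum_r A2 r).
split=> u.
  rewrite /expot; have -> : \sum_r phi r (z r) u =
      \sum_r A0 r + (\sum_r A1 r) * u + (\sum_r A2 r) * (u * u).
    rewrite !mulr_suml -!big_split/=; apply: eq_bigr => r _.
    rewrite /A0 /A1 /A2 /phi; case: ifP => _; last by ring.
    by rewrite -/(embed z r) -/(v r) -/K; ring.
  by ring.
rewrite /dexpot.
have -> : \sum_r (if L01 r then k1 / n%:R * (embed z r - n%:R * x r - D r * u) * D r else 0) =
    - (\sum_r A1 r) - 2 * (\sum_r A2 r) * u.
  rewrite mulr_sumr mulr_suml -sumrN -sumrB; apply: eq_bigr => r _.
  rewrite /A1 /A2; case: ifP => _; last by ring.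
  by rewrite -/(v r) /K; field.
by ring.
Qed.

Lemma is_derive_subsol z u :
  is_derive u (1 : R) (subsol z) (dexpot z u * expR (expot z u)).
Proof.
have [a0 [a1 [a2 [E dE]]]] := expot_quad z.
have -> : subsol z = fun v => expR (a0 + a1 * v + a2 * (v * v)) - b.
  by apply/funext => v; rewrite /subsol E.
by rewrite E dE; apply: is_derive_eq; rewrite /GRing.scale/=; ring.
Qed.

Lemma continuous_dsubsol z : continuous (fun u => dexpot z u * expR (expot z u)).
Proof.
have [a0 [a1 [a2 [E dE]]]] := expot_quad z.
have -> : (fun u => dexpot z u * expR (expot z u)) =
    fun v => (a1 + 2 * a2 * v) * expR (a0 + a1 * v + a2 * (v * v)).
  by apply/funext => v; rewrite E dE.
move=> u; apply: cvgM.
  by apply: cvgD; [exact: cvg_cst|apply: cvgM; [exact: cvg_cst|exact: cvg_id]].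
apply: continuous_comp; last exact: continuous_expR.
apply: cvgD; [apply: cvgD; [exact: cvg_cst|apply: cvgM; [exact: cvg_cst|exact: cvg_id]]|].
by apply: cvgM; [exact: cvg_cst|apply: cvgM; exact: cvg_id].
Qed.

(** [p] is minus the slope of the quadratic potential, thus the tilt felt by route [r], and [h] is
    half its second difference: a step up changes the exponent by [p - h], a step down by
    [- p - h]. *)
Let p z u r : R := - (k1 / n%:R * (embed z r - n%:R * x r - D r * u)).
Let h : R := k1 / (2 * n%:R).

Lemma phi_up z u r : phi r (z r).+1 u - phi r (z r) u =
  if L01 r then - (p z u r - h)
  else k2 / mu (val r) * (embed z r / (n%:R * rho mu r) + w r) ^+ q.+1.
Proof.
have n0 : n%:R != 0 :> R by rewrite pnatr_eq0 -lt0n.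
rewrite /phi; case: ifP => _.
  by rewrite /p /h -natr1 /embed; field.
have -> : embed z r / (n%:R * rho mu r) + w r = (z r).+1%:R * w r.
  by rewrite -natr1 /embed /w; ring.
rewrite big_ord_recr/=; ring.
Qed.

Lemma phi_down z u r : (0 < z r)%N -> phi r (z r).-1 u - phi r (z r) u =
  if L01 r then - (- p z u r - h)
  else - (k2 / mu (val r) * (embed z r / (n%:R * rho mu r)) ^+ q.+1).
Proof.
have n0 : n%:R != 0 :> R by rewrite pnatr_eq0 -lt0n.
move=> zr; rewrite /phi; case: ifP => _.
  by rewrite /p /h /embed -subn1 natrB//; field.
rewrite /embed; case: (z r) zr => // k _; rewrite big_ord_recr/= /w; ring.
Qed.

(* The contribution of route [r] to the generator of [expR (expot z u)],
   relative to [expR (expot z u)] itself. *)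
Definition gterm z u r : R :=
  if L01 r then
    lam (val r) * (expR (p z u r - h) - 1) +
    muX C mu (embed z) r * (expR (- p z u r - h) - 1) - p z u r * D r
  else
    lam (val r) * (expR (- (k2 / mu (val r) * (embed z r / (n%:R * rho mu r) + w r) ^+ q.+1)) - 1) +
    muX C mu (embed z) r * (expR (k2 / mu (val r) * (embed z r / (n%:R * rho mu r)) ^+ q.+1) - 1).

(** [b] cancels in the differences, and the moving centre of the quadratic potential supplies the
    Legendre term [- p * D]. *)
Lemma generator_subsol z u :
  dexpot z u * expR (expot z u) + generator C mu (subsol ^~ u) z =
  expR (expot z u) * (c + \sum_r gterm z u r).
Proof.
have upE r : expot (up z r) u = expot z u - (phi r (z r).+1 u - phi r (z r) u).
  by rewrite /expot (sum_up (fun r k => phi r k u)); ring.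
have downE r : expot (down z r) u = expot z u - (phi r (z r).-1 u - phi r (z r) u).
  by rewrite /expot (sum_down (fun r k => phi r k u)); ring.
rewrite mulrDr mulrC /dexpot mulrDr -addrA; congr (_ + _).
rewrite mulr_sumr [RHS]mulr_sumr /generator -big_split/=; apply: eq_bigr => r _.
rewrite /subsol upE phi_up /gterm.
have [zr|zr] := posnP (z r).
  rewrite muX_eq0// !mul0r; case: ifP => _; last by rewrite expRD; ring.
  by rewrite opprK expRD /p; ring.
rewrite downE phi_down//; case: ifP => _; last by rewrite opprK !expRD; ring.
rewrite [- - (p z u r - h)]opprK [- - (- p z u r - h)]opprK.
rewrite (expRD (expot z u) (p z u r - h)) (expRD (expot z u) (- p z u r - h)).
by move: (expR (p z u r - h)) (expR (- p z u r - h)) => X Y; rewrite /p; ring.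
Qed.

End Potential.
End Lower.

(** * Lower bound *)

Section LowerBound.
Variables (R : realType) (N : nat) (C : 'I_N -> R) (lam mu : route N -> R).
Hypotheses (C_gt0 : forall i, 0 < C i) (lam_ge0 : forall r, 0 <= lam r).
Hypothesis mu_gt0 : forall r, 0 < mu r.
Hypothesis erg : ergodic C lam mu.
Local Notation state := (act lam -> nat).
Local Notation vec := (act lam -> R).
Variable nrm : vec -> R.
Variables (c0 c1 : R).
Hypotheses (c0_gt0 : 0 < c0) (c1_ge0 : 0 <= c1).
Hypothesis coord_le : forall (v : vec) r, `|v r| <= c0 * nrm v.
Hypothesis norm_le : forall (v : vec) t, 0 <= t -> (forall r, `|v r| <= t) -> nrm v <= c1 * t.

Section Terms.
Variables (L : pred (act lam)) (x D : vec) (n q : nat) (k1 k2 : R).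
Hypotheses (xL : face L x) (LD : in_span L D) (n_gt0 : (0 < n)%N).
Hypotheses (k1_ge0 : 0 <= k1) (k2_ge0 : 0 <= k2).
Variables (z : state) (u : R).
Local Notation term := (gterm C mu L x D n q k1 k2 z u).

(** An instance of [lfun_ge_any_tilt], insensitive to the slope [p]. The bound [e1 <= b0 / 2] keeps
    the actual rate above [b0 / 2]; the last error comes from the second difference and vanishes for
    large [n]. *)
Lemma gterm_face r (e1 b0 S : R) : L r -> 0 < b0 -> b0 <= muX C mu x r ->
  `|D r| + lam (val r) + muX C mu x r <= S ->
  `|muX C mu (embed z) r - muX C mu x r| <= e1 -> e1 <= b0 / 2 ->
  - lfun (D r) (lam (val r)) (muX C mu x r) - e1 * (1 + 2 * S / b0)
    - S * (k1 / (2 * n%:R)) <= term r.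
Proof.
move=> Lr b00 bm DS me1 e1b; rewrite /gterm Lr/=.
have l0 : 0 < lam (val r) := valP r.
have m0 : 0 < muX C mu x r := lt_le_trans b00 bm.
have m'b : b0 / 2 <= muX C mu (embed z) r.
  by move: me1; rewrite ler_norml => /andP[? ?]; lra.
have m'0 : 0 < muX C mu (embed z) r by lra.
have h0 : 0 <= k1 / (2 * n%:R) by rewrite divr_ge0// mulr_ge0.
apply: le_trans (lfun_ge_any_tilt (D r) l0 m0 _ m'0 h0).
set S' := `|D r| + _ + _ in DS *.
have S'0 : 0 <= S' by rewrite /S' !addr_ge0// ltW.
have h1 : S' / muX C mu (embed z) r <= 2 * S / b0.
  have -> : 2 * S / b0 = S / (b0 / 2) by field; exact: lt0r_neq0.
  apply: ler_pM => //; first by rewrite invr_ge0 ltW.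
  by rewrite lef_pV2 ?posrE// divr_gt0.
have h2 : `|muX C mu (embed z) r - muX C mu x r| * (1 + S' / muX C mu (embed z) r)
    <= e1 * (1 + 2 * S / b0).
  apply: ler_pM => //; last by rewrite lerD2l.
  by rewrite addr_ge0// divr_ge0// ltW.
have h3 : S' * (k1 / (2 * n%:R)) <= S * (k1 / (2 * n%:R)) by rewrite ler_wpM2r.
by lra.
Qed.

(** Suppressing all arrivals costs [lam]. A service, possible only if [z r >= 1], has exponent
    [k1 / n * (z r - 1 / 2) >= 0] and so contributes nonnegatively. *)
Lemma gterm_Lambda1 r : Lambda1 L r -> - lam (val r) <= term r.
Proof.
move=> L1; rewrite /gterm L1 orbT; have /andP[nL _] := L1.
rewrite (LD nL) (face_eq0 xL nL) mulr0 subr0 mul0r subr0 mulr0 subr0.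
have n0 : 0 < n%:R :> R by rewrite ltr0n.
have h1 : - lam (val r) <= lam (val r) * (expR (- (k1 / n%:R * embed z r) - k1 / (2 * n%:R)) - 1).
  by rewrite mulrBr mulr1 -subr_ge0 opprK subrK mulr_ge0// expR_ge0.
rewrite -[leLHS]addr0; apply: lerD => //.
have [zr|zr] := posnP (z r); first by rewrite muX_eq0// mul0r.
apply: mulr_ge0; first by apply: muX_ge0 => // r'; exact: embed_ge0.
rewrite subr_ge0; apply: le_trans (expR_ge1Dx _); rewrite lerDl.
have -> : - - (k1 / n%:R * embed z r) - k1 / (2 * n%:R) = k1 / n%:R * (embed z r - 1 / 2).
  by field; exact: lt0r_neq0.
rewrite mulr_ge0 ?divr_ge0 ?(ltW n0)// /embed.
have : (1 : R) <= (z r)%:R by rewrite ler1n.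
by lra.
Qed.

(** [expR t >= 1 + t] linearises both jumps. The arrival sees the power at [z r + 1] instead of
    [z r], whence the second error, bounded later by a multiple of [1 / n]. *)
Lemma gterm_Lambda2 r : ~~ L r && ~~ Lambda1 L r ->
  let v := n%:R^-1 * embed z r / rho mu r in let w := (n%:R * rho mu r)^-1 in
  - k2 * (v ^+ q.+1 * (rho mu r - nu C (embed z) r))
    - k2 * rho mu r * ((v + w) ^+ q.+1 - v ^+ q.+1) <= term r.
Proof.
case/andP => /negbTE nL /negbTE nL1; set v := _ / rho mu r; set w := (_ * _)^-1 => /=.
rewrite /gterm nL nL1/=.
have -> : embed z r / (n%:R * rho mu r) = v by rewrite /v invfM; ring.
rewrite -/w.
have muE : muX C mu (embed z) r = mu (val r) * nu C (embed z) r by [].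
have m0 := mu_gt0 (val r).
set A := k2 / _ * (v + w) ^+ q.+1; set A' := k2 / _ * v ^+ q.+1.
have e1 : 1 - A <= expR (- A) by exact: expR_ge1Dx.
have e2 : 1 + A' <= expR A' by exact: expR_ge1Dx.
have l1 : lam (val r) * (- A) <= lam (val r) * (expR (- A) - 1) by rewrite ler_wpM2l//; lra.
have l2 : muX C mu (embed z) r * A' <= muX C mu (embed z) r * (expR A' - 1).
  apply: ler_wpM2l; last by lra.
  by apply: muX_ge0 => // r'; exact: embed_ge0.
have E1 : lam (val r) * (- A) = - (k2 * rho mu r * (v + w) ^+ q.+1).
  by rewrite /A /rho; ring.
have E2 : muX C mu (embed z) r * A' = k2 * nu C (embed z) r * v ^+ q.+1.
  by rewrite muE /A'; field; exact: lt0r_neq0.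
by lra.
Qed.

End Terms.

Local Ltac lra_goal :=
  clear -C_gt0 lam_ge0 mu_gt0 erg c0_gt0 c1_ge0 coord_le norm_le; lra.

(** The constants come in the order [dl], [k2], [e2], [ep1], [k1]: the steepness on Lambda_2 fixes
    the tolerance [e2] of [stability], and [k1] must then confine Lambda_1 within [g * e2]. Only
    [tau0] is chosen uniformly in [x]. *)
Lemma logP_lower (L : pred (act lam)) (D : vec) (m B e : R) :
  in_span L D -> 0 < m -> 0 < e ->
  exists2 tau0, 0 < tau0 & forall tau, 0 < tau < tau0 ->
    forall x : vec, face L x -> (forall r, L r -> m <= x r <= B) ->
    forall delta, 0 < delta ->
    exists2 eps0, 0 < eps0 & forall eps, 0 < eps < eps0 ->
      exists n0, forall n (y : state), (n0 <= n)%N -> startset nrm x eps n y ->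
      ((n%:R * tau * (- Lrate C mu x D - e))%:E <= logP C mu nrm x D tau delta n y)%E.
Proof.
move=> LD m0 e0.
pose nR : R := #|{: act lam}|%:R.
have nR0 : 0 <= nR by rewrite ler0n.
have nR1 : 0 < nR + 1 by rewrite ltr_wpDl.
(* The error budget is [e / 4] for the route terms, [e / 8] for [stability] and [e / 8] for the
   power increments; together they use the [e / 2] contained in [c]. *)
pose e' := e / (8 * (nR + 1)).
have e'0 : 0 < e' by rewrite divr_gt0// mulr_gt0.
have [b0 b00 Hb0] := muX_face_gt C_gt0 mu_gt0 L B m0.
pose SS := 1 + \sum_(r : act lam) (`|D r| + lam (val r) + mu (val r) * C (val (val r)).1).
have F0 (r : act lam) : 0 <= `|D r| + lam (val r) + mu (val r) * C (val (val r)).1.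
  by rewrite !addr_ge0// mulr_ge0// ltW.
have SS0 : 0 < SS by rewrite /SS ltr_pwDl// sumr_ge0.
have A0 : 0 < 1 + 2 * SS / b0 by rewrite addr_gt0// divr_gt0// mulr_gt0.
pose e1 := Num.min (b0 / 2) (e' / (1 + 2 * SS / b0)).
have e10 : 0 < e1 by rewrite /e1 lt_min; apply/andP; split; exact: divr_gt0.
have e1b : e1 <= b0 / 2 by rewrite /e1 ge_min lexx.
have e1e : e1 * (1 + 2 * SS / b0) <= e' by rewrite -ler_pdivlMr// /e1 ge_min lexx orbT.
have [eta eta0 Heta] := muX_close C_gt0 mu_gt0 L m0 e10.
have [tau0 tau00 Htau] := exists_tau D eta0.
have [q [g [g0 Hstab]]] := stability C_gt0 mu_gt0 erg L.
exists tau0 => // tau /andP[t0 tt] x xL xmB delta d0.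
have x0 := face_ge0 xL.
have rho0 (r : act lam) : 0 < rho mu r := rho_gt0 mu_gt0 r.
have c1p : 0 < c1 + 1 by rewrite ltr_wpDl.
pose dl := Num.min (eta / 2) (delta / (c1 + 1)).
have dl0 : 0 < dl by rewrite /dl lt_min; apply/andP; split; exact: divr_gt0.
have dle : dl <= eta / 2 by rewrite /dl ge_min lexx.
have c1dl : c1 * dl < delta.
  have : dl * (c1 + 1) <= delta by rewrite -ler_pdivlMr// /dl ge_min lexx orbT.
  by move: dl0; lra_goal.
pose c := Lrate C mu x D + e / 2.
(* Where the subsolution is nonnegative the total potential is at most [G * n]; the steepness of
   each potential is set against [G + 1]. *)
pose G := (`|c| + e / 2) * tau.
have G0 : 0 <= G by rewrite mulr_ge0 ?(ltW t0)// addr_ge0// ltW// divr_gt0.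
have [bb bb0 Hbb] := @exists_lower_bound R _
  (fun r : act lam => (dl / rho mu r) ^+ q.+2 * rho mu r / q.+2%:R / mu (val r))
  (fun r => ltac:(by rewrite !divr_gt0// mulr_gt0// exprn_gt0// divr_gt0)).
(* By [sum_expr_ge], a Lambda_2 coordinate above [dl * n] then has potential at least
   [(G + 1) * n]. *)
pose k2 := (G + 1) / bb.
have k20 : 0 < k2 by rewrite divr_gt0// ltr_wpDl.
pose P := \sum_(r : act lam) rho mu r.
have P0 : 0 <= P by apply: sumr_ge0 => r _; exact: ltW.
have kP0 : 0 < 8 * (k2 * P + 1) by rewrite mulr_gt0// ltr_wpDl// mulr_ge0// ltW.
pose e2 := Num.min 1 (e / (8 * (k2 * P + 1))).
have e20 : 0 < e2 by rewrite /e2 lt_min ltr01 divr_gt0.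
have e21 : e2 <= 1 by rewrite /e2 ge_min lexx.
have e2e : k2 * P * e2 ^+ q.+1 <= e / 8.
  apply: (@le_trans _ _ (k2 * P * e2)).
    apply: ler_wpM2l; first exact: mulr_ge0 (ltW k20) P0.
    by rewrite exprS ler_piMr ?(ltW e20)// exprn_ile1// ltW.
  have : e2 * (8 * (k2 * P + 1)) <= e by rewrite -ler_pdivlMr// /e2 ge_min lexx orbT.
  by move: e20; lra_goal.
pose ep1 := Num.min dl (g * e2).
have ep10 : 0 < ep1 by rewrite /ep1 lt_min dl0 mulr_gt0.
have ep1d : ep1 <= dl by rewrite /ep1 ge_min lexx.
have ep1g : ep1 <= g * e2 by rewrite /ep1 ge_min lexx orbT.
(* At distance [ep1 * n] from its centre the quadratic potential equals [(G + 1) * n]. *)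
pose k1 := 2 * (G + 1) / ep1 ^+ 2.
have k10 : 0 < k1 by rewrite divr_gt0 ?exprn_gt0// mulr_gt0// ltr_wpDl.
pose KK := k2 * (q.+1%:R * \sum_(r : act lam) ((dl + 1) / rho mu r) ^+ q).
pose W := \sum_(r : act lam) (k1 / 2 + k2 / mu (val r)).
have W0 (r : act lam) : 0 <= k1 / 2 + k2 / mu (val r).
  by rewrite addr_ge0// divr_ge0// ltW.
have Wp : 0 < 4 * (W + 1) by rewrite mulr_gt0// ltr_wpDl// sumr_ge0.
have [rm rm0 Hrm] := exists_lower_bound rho0.
(* The initial potential has to stay below [e / 4 * T]. The bound 1 makes squares at most linear in
   [ee], and [rm] keeps [y r / (n * rho)] at most 1, as [sum_expr_le] requires. *)
pose ee := Num.min (Num.min 1 rm) (e * tau / (4 * (W + 1))).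
have ee0 : 0 < ee by rewrite /ee !lt_min ltr01 rm0/= divr_gt0// mulr_gt0.
exists (ee / c0); first exact: divr_gt0.
move=> eps /andP[ep0 epee].
have ceps : c0 * eps <= ee by rewrite mulrC -ler_pdivlMr// ltW.
have eeW : ee * (4 * (W + 1)) <= e * tau by rewrite -ler_pdivlMr// /ee ge_min lexx orbT.
have ee1 : ee <= 1 by rewrite /ee !ge_min lexx.
have eer : ee <= rm by rewrite /ee !ge_min lexx orbT.
(* For [n >= X] the three summands make the second difference negligible, the power increments
   negligible, and [1 <= e / 4 * T]. *)
pose X := SS * k1 / (2 * e') + 8 * KK / e + 4 / (e * tau).
have KK0 : 0 <= KK.
  rewrite mulr_ge0 ?(ltW k20)// mulr_ge0//; apply: sumr_ge0 => r _.
  by rewrite exprn_ge0// divr_ge0 ?(ltW (rho0 _))// addr_ge0// ltW.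
have X1 : 0 <= SS * k1 / (2 * e').
  by rewrite ltW// divr_gt0// mulr_gt0.
have X2 : 0 <= 8 * KK / e by rewrite divr_ge0 ?(ltW e0)// mulr_ge0.
have X3 : 0 <= 4 / (e * tau) by rewrite ltW// divr_gt0// mulr_gt0.
exists (Num.bound X).+1 => n y nX ys.
have Xn : X <= n%:R.
  have : X < (Num.bound X)%:R by apply: archi_boundP; rewrite !addr_ge0.
  by move=> /ltW/le_trans; apply; rewrite ler_nat (leq_trans _ nX).
have n_gt0 : (0 < n)%N by exact: leq_trans nX.
have n0 : 0 < n%:R :> R by rewrite ltr0n.
have nSS : SS * (k1 / (2 * n%:R)) <= e'.
  have : SS * k1 / (2 * e') <= n%:R by move: Xn X1 X2 X3; rewrite /X; lra_goal.
  rewrite ler_pdivrMr; last exact: mulr_gt0.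
  move=> h; rewrite mulrA ler_pdivrMr; last exact: mulr_gt0.
  by move: h; lra_goal.
have nKK : KK / n%:R <= e / 8.
  have : 8 * KK / e <= n%:R by move: Xn X1 X2 X3; rewrite /X; lra_goal.
  by rewrite ler_pdivrMr// ler_pdivrMr// => h; move: h; lra_goal.
have nT : 1 <= e / 4 * (n%:R * tau).
  have : 4 / (e * tau) <= n%:R by move: Xn X1 X2 X3; rewrite /X; lra_goal.
  by rewrite ler_pdivrMr ?mulr_gt0//; lra_goal.
pose T := n%:R * tau; have T0 : 0 <= T by rewrite mulr_ge0// ltW.
pose b := expR (- (c + e / 2) * T).
have b0' : 0 < b := expR_gt0 _.
pose f := subsol mu L x D n q k1 k2 T c b.
have phi0 := phi_ge0 mu_gt0 L x D q n_gt0 (ltW k10) (ltW k20).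
have fphi (z : state) u r : 0 <= u <= T -> 0 <= f z u ->
    phi mu L x D n q k1 k2 r (z r) u <= G * n%:R.
  move=> /andP[u0 uT]; rewrite /f /subsol subr_ge0 ler_expR /expot => hf.
  apply: (@le_trans _ _ (\sum_r phi mu L x D n q k1 k2 r (z r) u)).
    exact: (@ler_sumT _ _ (fun r => phi mu L x D n q k1 k2 r (z r) u)).
  have : c * u <= `|c| * T.
    apply: le_trans (ler_norm _) _; rewrite normrM (ger0_norm u0); exact: ler_wpM2l.
  have -> : G * n%:R = (`|c| + e / 2) * T by rewrite /G /T; ring.
  by move: hf; lra_goal.
have fL01 (z : state) u r : 0 <= u <= T -> 0 <= f z u -> L r || Lambda1 L r ->
    `|embed z r - n%:R * x r - D r * u| <= ep1 * n%:R.
  move=> uT fz Lr; have := fphi z u r uT fz; rewrite /phi Lr.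
  rewrite -/(embed z r); move: (embed z r - _ - _) => Z hZ.
  rewrite leNgt; apply/negP => hz.
  have : (ep1 * n%:R) ^+ 2 <= Z ^+ 2.
    rewrite -(real_normK (num_real Z)) lerXn2r ?nnegrE// ?mulr_ge0 ?(ltW ep10)//.
    exact: ltW.
  move=> hZ2.
  have kp : 0 < k1 / (2 * n%:R) by rewrite divr_gt0// mulr_gt0.
  have := ler_wpM2l (ltW kp) hZ2.
  have -> : k1 / (2 * n%:R) * (ep1 * n%:R) ^+ 2 = (G + 1) * n%:R.
    by rewrite /k1; field; rewrite !lt0r_neq0.
  by move: hZ n0; lra_goal.
have fL2 (z : state) u r : 0 <= u <= T -> 0 <= f z u -> ~~ L r && ~~ Lambda1 L r ->
    n%:R^-1 * embed z r <= dl.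
  move=> uT fz /andP[nL nL1]; have := fphi z u r uT fz; rewrite /phi (negbTE nL) (negbTE nL1)/=.
  move=> hZ; rewrite leNgt; apply/negP => hz.
  have w0 := w_gt0 mu_gt0 n_gt0 r.
  have := @sum_expr_ge _ _ q.+1 (z r) (ltW w0).
  set Sm := \sum_(j < z r) _ in hZ * => hS.
  have h1 : (dl / rho mu r) ^+ q.+2 <= q.+2%:R * (n%:R * rho mu r)^-1 * Sm.
    apply: le_trans hS; apply: lerXn2r; rewrite ?nnegrE.
    - by rewrite divr_ge0// ltW.
    - by rewrite mulr_ge0// ltW.
    - have -> : (z r)%:R * (n%:R * rho mu r)^-1 = n%:R^-1 * embed z r / rho mu r.
        by rewrite /embed invfM; ring.
      by rewrite ler_pM2r ?invr_gt0// ltW.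
  have kq : 0 < k2 * rho mu r * n%:R / q.+2%:R / mu (val r).
    apply: divr_gt0 => //; apply: divr_gt0; last by rewrite ltr0n.
    by apply: mulr_gt0 => //; exact: mulr_gt0.
  have := ler_wpM2l (ltW kq) h1.
  have -> : k2 * rho mu r * n%:R / q.+2%:R / mu (val r) * (q.+2%:R * (n%:R * rho mu r)^-1 * Sm)
      = k2 / mu (val r) * Sm.
    have q2 : q.+2%:R != 0 :> R by rewrite pnatr_eq0.
    by move: (q.+2%:R) q2 => Q Q0; field; rewrite Q0 !lt0r_neq0.
  have -> : k2 * rho mu r * n%:R / q.+2%:R / mu (val r) * (dl / rho mu r) ^+ q.+2 =
     k2 * n%:R * ((dl / rho mu r) ^+ q.+2 * rho mu r / q.+2%:R / mu (val r)) by ring.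
  have := ler_wpM2l (mulr_ge0 (ltW k20) (ltW n0)) (Hbb r).
  have -> : k2 * n%:R * bb = (G + 1) * n%:R by rewrite /k2; field; exact: lt0r_neq0.
  move=> p1 p2; have := le_trans (le_trans p1 p2) hZ.
  by rewrite leNgt ltr_pM2r// ltrDl ltr01.
have fall (z : state) u r : 0 <= u <= T -> 0 <= f z u ->
    `|embed z r - n%:R * x r - D r * u| <= dl * n%:R.
  move=> uT fz; case: (boolP (L r || Lambda1 L r)) => [Lr|].
    by apply: le_trans (fL01 z u r uT fz Lr) _; rewrite ler_pM2r.
  rewrite negb_or => Lr; have := fL2 z u r uT fz Lr; have /andP[nL _] := Lr.
  rewrite (face_eq0 xL nL) (LD _ nL) mulr0 mul0r !subr0 ger0_norm ?embed_ge0//.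
  by rewrite ler_pdivrMl// mulrC.
have close (z : state) u r : 0 <= u <= T -> 0 <= f z u -> `|n%:R^-1 * embed z r - x r| <= eta.
  move=> uT fz; have := fall z u r uT fz; move: (uT) => /andP[u0 uT'] fr.
  have hD : `|D r * u| <= eta / 2 * n%:R.
    rewrite normrM (ger0_norm u0); apply: (@le_trans _ _ (`|D r| * T)); first exact: ler_wpM2l.
    rewrite /T mulrCA mulrC ler_pM2r//; apply: Htau; by rewrite (ltW t0) (ltW tt).
  have -> : n%:R^-1 * embed z r - x r =
      (embed z r - n%:R * x r - D r * u + D r * u) / n%:R.
    by field; exact: lt0r_neq0.
  rewrite normrM (gtr0_norm (x := n%:R^-1)) ?invr_gt0// ler_pdivrMr//.
  apply: le_trans (ler_normD _ _) _.
  have : dl * n%:R <= eta / 2 * n%:R by rewrite ler_pM2r.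
  by move: fr hD; lra_goal.
have ez0 (z : state) r : (0 : R) <= n%:R^-1 * embed z r.
  by rewrite mulr_ge0 ?embed_ge0// invr_ge0 ltW.
have mclose (z : state) u r : 0 <= u <= T -> 0 <= f z u -> L r || Lambda1 L r ->
    `|muX C mu (embed z) r - muX C mu x r| <= e1.
  move=> uT fz Lr; rewrite (muX_scaled C mu z r n_gt0).
  apply: (Heta _ _ xL (fun r' Lr' => proj1 (andP (xmB r' Lr'))) (ez0 z) _ r Lr) => r'.
  exact: close uT fz.
have bal (z : state) u : 0 <= u <= T -> 0 <= f z u ->
    0 <= c + \sum_r gterm C mu L x D n q k1 k2 z u r.
  move=> uT fz.
  pose v r := n%:R^-1 * embed z r / rho mu r; pose w (r : act lam) : R := (n%:R * rho mu r)^-1.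
  pose t1 r := if L r then - lfun (D r) (lam (val r)) (muX C mu x r)
    else if Lambda1 L r then - lam (val r) else 0.
  pose s1 r := v r ^+ q.+1 * (rho mu r - nu C (fun r => n%:R^-1 * embed z r) r).
  pose s2 (r : act lam) : R := rho mu r * ((v r + w r) ^+ q.+1 - v r ^+ q.+1).
  pose L2 (r : act lam) := ~~ L r && ~~ Lambda1 L r.
  have lower r : t1 r - 2 * e' + ((if L2 r then - k2 * s1 r else 0) +
      (if L2 r then - k2 * s2 r else 0)) <= gterm C mu L x D n q k1 k2 z u r.
    rewrite /t1 /L2; case: (boolP (L r)) => [Lr|nL] /=.
      have SSr : `|D r| + lam (val r) + muX C mu x r <= SS.
        have := @ler_sumT _ _ _ r F0; have := muX_le C_gt0 mu_gt0 r x0.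
        by rewrite /SS; lra_goal.
      have := gterm_face n q k2 (ltW k10) u Lr b00 (Hb0 x xL xmB r Lr) SSr
        (mclose z u r uT fz ltac:(by rewrite Lr)) e1b.
      by move: e1e nSS; lra_goal.
    case: (boolP (Lambda1 L r)) => [L1|nL1] /=.
      by have := gterm_Lambda1 q k2 xL LD n_gt0 (ltW k10) z u L1; move: e'0; lra_goal.
    have := @gterm_Lambda2 L x D n q k1 k2 z u r.
    rewrite nL nL1 => /(_ isT); rewrite /s1 /s2 nu_scale ?invr_gt0//.
    by rewrite -/(v r) -/(w r); move: e'0; lra_goal.
  have := ler_sum (index_enum {: act lam}) (P := xpredT) (fun r _ => lower r).
  rewrite big_split/= sumrB big_split/= -!big_mkcond/=.
  rewrite -[\sum_(r | L2 r) - k2 * s1 r]mulr_sumr -[\sum_(r | L2 r) - k2 * s2 r]mulr_sumr.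
  have -> : \sum_r t1 r = - Lrate C mu x D.
    rewrite (LrateE C mu xL LD) -sumrN; apply: eq_bigr => r _; rewrite /t1.
    by case: ifP => // _; case: ifP => // _; rewrite oppr0.
  have n2e : \sum_(r : act lam) (2 * e') <= e / 4.
    rewrite sumr_const -[_ *+ _]mulr_natl -/nR /e'.
    have -> : 2 * (e / (8 * (nR + 1))) = (e / 4) / (nR + 1) by field; exact: lt0r_neq0.
    by rewrite mulrA ler_pdivrMr//; move: e0; lra_goal.
  have S1 : \sum_(r | L2 r) s1 r <= P * e2 ^+ q.+1.
    apply: (Hstab _ e2 (ez0 z) e20) => r L1.
    apply: le_trans ep1g; have /andP[nL _] := L1.
    have := fL01 z u r uT fz ltac:(by rewrite L1 orbT).
    rewrite (face_eq0 xL nL) (LD _ nL) mulr0 mul0r !subr0 => /(le_trans (ler_norm _)).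
    by rewrite ler_pdivrMl// mulrC.
  have S2 : k2 * \sum_(r | L2 r) s2 r <= e / 8.
    apply: le_trans nKK; rewrite /KK -mulrA ler_pM2l// mulr_sumr mulr_suml.
    rewrite big_mkcond/=; apply: ler_sum => r _; case: ifPn => [L2r|_]; last first.
      rewrite mulr_ge0 ?invr_ge0 ?(ltW n0)// mulr_ge0// exprn_ge0//.
      by rewrite divr_ge0 ?(ltW (rho0 _))// addr_ge0// ltW.
    have vr0 : 0 <= v r by rewrite divr_ge0 ?ez0// ltW.
    have wr0 : 0 < w r := w_gt0 mu_gt0 n_gt0 r.
    have vw : v r + w r <= (dl + 1) / rho mu r.
      rewrite mulrDl; apply: lerD.
        by rewrite ler_pM2r ?invr_gt0//; exact: fL2 uT fz L2r.
      by rewrite /w invfM ler_pM2r ?invr_gt0// invf_le1// ler1n.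
    apply: (@le_trans _ _ (rho mu r * (q.+1%:R * w r * (v r + w r) ^+ q))).
      by rewrite ler_pM2l// exprDB_le// ltW.
    have -> : rho mu r * (q.+1%:R * w r * (v r + w r) ^+ q) =
        q.+1%:R * (v r + w r) ^+ q / n%:R.
      by rewrite /w; move: (q.+1%:R) (_ ^+ q) => Q V; field; rewrite !lt0r_neq0.
    rewrite ler_pM2r ?invr_gt0// ler_wpM2l// lerXn2r// nnegrE.
      by rewrite addr_ge0// ltW.
    by rewrite divr_ge0 ?(ltW (rho0 _))// addr_ge0// ltW.
  have := ler_wpM2l (ltW k20) S1.
  by rewrite !mulNr /c; move: n2e S2 e2e; lra_goal.
have sub := @subsolution_le_tubeProb R N C lam mu C_gt0 lam_ge0 mu_gt0 nrm T
  (fun r => n%:R * x r) D (delta * n%:R) (expR (`|c| * T)) f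
  (fun z u => dexpot L x D n k1 c z u * expR (expot mu L x D n q k1 k2 T c z u)) T0
  (ltW (expR_gt0 _)).
have expot_le z u : expot mu L x D n q k1 k2 T c z u <= - c * (T - u).
  by rewrite /expot gerBl sumr_ge0.
have {}sub : ((f y 0)%:E <= tubeProb C mu nrm T (fun r => (n%:R * x r)%R) D (delta * n%:R) y)%E.
  apply: sub.
  - move=> z u /andP[u0 uT]; apply: (@le_trans _ _ (expR (expot mu L x D n q k1 k2 T c z u))).
      by rewrite /f /subsol gerBl ltW.
    rewrite ler_expR; apply: le_trans (expot_le z u) _.
    apply: le_trans (ler_norm _) _; rewrite normrM normrN ler_wpM2l// ger0_norm ?subr_ge0//.
    by rewrite gerBl.
  - by move=> z u; exact: is_derive_subsol.
  - by move=> z; exact: continuous_dsubsol.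
  - move=> z; apply: (@le_trans _ _ (expR (expot mu L x D n q k1 k2 T c z T))).
      by rewrite /f /subsol gerBl ltW.
    by rewrite -[leRHS]expR0 ler_expR; apply: le_trans (expot_le z T) _; rewrite subrr mulr0.
  - move=> z u uT fz.
    apply: (@le_lt_trans _ _ (c1 * (dl * n%:R))); last by rewrite mulrA ltr_pM2r.
    by apply: norm_le => [|r]; [rewrite mulr_ge0// ltW|exact: fall].
  - move=> z u uT fz; rewrite /f generator_subsol//.
    by rewrite mulr_ge0 ?expR_ge0// bal.
apply: elog_ge; first exact: tubeProb_le1.
apply: le_trans sub; rewrite lee_fin /f /subsol.
have phiy r : phi mu L x D n q k1 k2 r (y r) 0 <= (k1 / 2 + k2 / mu (val r)) * (ee * n%:R).
  have yr : `|embed y r - n%:R * x r| <= ee * n%:R.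
    apply: le_trans (coord_le (fun r => embed y r - n%:R * x r) r) _.
    apply: (@le_trans _ _ (c0 * (eps * n%:R))).
      by rewrite ler_pM2l//; exact: ltW.
    by rewrite mulrA ler_pM2r.
  have een : 0 <= ee * n%:R by rewrite mulr_ge0// ltW.
  have k2m : 0 <= k2 / mu (val r) by rewrite divr_ge0// ltW.
  rewrite mulrDl /phi; case: ifPn => [Lr|].
    rewrite -[leLHS]addr0; apply: lerD; last exact: mulr_ge0.
    rewrite mulr0 subr0 -/(embed y r).
    have : (embed y r - n%:R * x r) ^+ 2 <= ee * n%:R * n%:R.
      rewrite -(real_normK (num_real _)) expr2; apply: ler_pM => //.
      by apply: le_trans yr _; rewrite ler_piMl.
    move=> hy; have := ler_wpM2l (divr_ge0 (ltW k10) (mulr_ge0 (ler0n R 2) (ltW n0))) hy.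
    by have -> : k1 / (2 * n%:R) * (ee * n%:R * n%:R) = k1 / 2 * (ee * n%:R)
      by field; exact: lt0r_neq0.
  rewrite negb_or => /andP[nL nL1]; move: yr; rewrite (face_eq0 xL nL) mulr0 subr0.
  rewrite ger0_norm ?embed_ge0// => yr.
  rewrite -[leLHS]add0r; apply: lerD; first by rewrite mulr_ge0// divr_ge0// ltW.
  apply: ler_wpM2l => //; apply: (le_trans _ yr); apply: sum_expr_le.
    exact: ltW (w_gt0 mu_gt0 n_gt0 r).
  rewrite ler_pdivrMr; last exact: mulr_gt0.
  rewrite mul1r [leRHS]mulrC; apply: le_trans yr _.
  by rewrite ler_pM2r//; exact: le_trans eer (Hrm r).
have phis : \sum_r phi mu L x D n q k1 k2 r (y r) 0 <= e / 4 * T.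
  apply: (@le_trans _ _ (W * (ee * n%:R))).
    by rewrite /W mulr_suml; apply: ler_sum => r _; exact: phiy.
  have := ler_wpM2r (ltW n0) eeW; have : 0 <= ee * n%:R by rewrite mulr_ge0// ltW.
  by rewrite /T; lra_goal.
(* [Y] is also the value of [b]. The exponential at the start is at least
   [Y * expR (e / 4 * T) >= 2 * Y], so subtracting [b] leaves at least [Y], the bound sought. *)
pose Y := expR (- (c + e / 2) * T).
have hE : Y * expR (e / 4 * T) <= expR (expot mu L x D n q k1 k2 T c y 0).
  rewrite /Y -expRD ler_expR /expot subr0; move: phis; lra_goal.
have h2 : 2 <= expR (e / 4 * T) by have := expR_ge1Dx (e / 4 * T); move: nT; rewrite -/T; lra_goal.
have -> : n%:R * tau * (- Lrate C mu x D - e) = - (c + e / 2) * T by rewrite /c /T; field.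
rewrite -/Y /b -/Y; have Y0 : 0 < Y := expR_gt0 _.
by have := ler_wpM2l (ltW Y0) h2; move: hE; lra_goal.
Qed.

End LowerBound.

(** * Equivalence with the sup norm *)

Section NormEquivalence.
Variables (R : realType) (T : finType) (nrm : (T -> R) -> R).
Hypothesis nrm_norm : is_norm nrm.

Let nrmZ (a : R) v : nrm (fun t => a * v t) = `|a| * nrm v.
Proof. by case: nrm_norm => _ + _; exact. Qed.

Let nrmD v w : nrm (fun t => v t + w t) <= nrm v + nrm w.
Proof. by case: nrm_norm => _ _; exact. Qed.

Let nrm0 : nrm (fun=> 0) = 0.
Proof.
have -> : (fun=> 0) = (fun t : T => 0 * 0) :> (T -> R) by apply/funext => t; rewrite mul0r.
by rewrite (nrmZ 0 (fun=> 0)) normr0 mul0r.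
Qed.

Let nrm_ge0 v : 0 <= nrm v.
Proof.
have := nrmD v (fun t => -1 * v t); rewrite nrmZ normrN1 mul1r.
have -> : (fun t => v t + -1 * v t) = (fun=> 0) by apply/funext => t; rewrite mulN1r subrr.
by rewrite nrm0; lra.
Qed.

Lemma norm_le_sup : exists2 c, 0 <= c &
  forall v t, 0 <= t -> (forall r, `|v r| <= t) -> nrm v <= c * t.
Proof.
pose e r := (fun t => (t == r)%:R) : T -> R.
exists (\sum_r nrm (e r)); first by apply: sumr_ge0.
move=> v t t0 vt.
have key (s : seq T) : nrm (fun u => \sum_(r <- s) v r * e r u) <= \sum_(r <- s) t * nrm (e r).
  elim: s => [|r s IH].
    by rewrite big_nil; under eq_fun do rewrite big_nil; rewrite nrm0.
  rewrite big_cons; under eq_fun do rewrite big_cons.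
  apply: le_trans (nrmD _ _) _; apply: lerD => //.
  by rewrite nrmZ ler_wpM2r.
have := key (index_enum T); rewrite -mulr_sumr mulrC; apply: le_trans.
have -> : (fun u => \sum_r v r * e r u) = v => //.
apply/funext => u; rewrite (bigD1 u)//= /e eqxx mulr1 big1 ?addr0// => r ru.
by rewrite eq_sym (negbTE ru) mulr0.
Qed.

(** [nrm] is Lipschitz for the sup norm by [norm_le_sup], so it attains a positive minimum on the
    compact unit sphere of row vectors; scaling does the rest. *)
Lemma sup_le_norm : exists2 c, 0 < c & forall v r, `|v r| <= c * nrm v.
Proof.
have [c1 c10 Hc1] := norm_le_sup.
pose n := #|T|.
pose of_row (w : 'rV[R]_n) (t : T) : R := w ord0 (enum_rank t).
have coord (w : 'rV[R]_n) i : `|w ord0 i| <= `|w|.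
  rewrite [leRHS]/Num.norm /= mx_normrE; apply/bigmax_geP; right => /=.
  by exists (ord0, i).
have fle (w : 'rV[R]_n) : nrm (of_row w) <= c1 * `|w|.
  by apply: Hc1 => // t; exact: coord.
pose f (w : 'rV[R]_n) := nrm (of_row w).
have flip (w w' : 'rV[R]_n) : f w - f w' <= c1 * `|w - w'|.
  rewrite lerBlDl; apply: (@le_trans _ _ (f w' + f (w - w'))); last by rewrite lerD2l; exact: fle.
  apply: le_trans (nrmD _ _); rewrite le_eqVlt; apply/orP; left; apply/eqP; congr nrm.
  by apply/funext => t; rewrite /of_row !mxE addrCA subrr addr0.
have cf : continuous f.
  move=> w; apply/(@cvgrPdist_lt _ _ _ (nbhs w) (nbhs_filter w)) => e e0.
  have c1p : 0 < c1 + 1 by rewrite ltr_wpDl.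
  near=> w'.
  have d : `|w - w'| < e / (c1 + 1).
    near: w'; move: (divr_gt0 e0 c1p); move: (e / (c1 + 1)).
    by apply/(@cvgrPdist_lt _ _ _ (nbhs w) (nbhs_filter w) id); exact: cvg_id.
  have : c1 * `|w - w'| < e.
    apply: (@le_lt_trans _ _ ((c1 + 1) * `|w - w'|)); first by rewrite ler_wpM2r// lerDl.
    by rewrite mulrC -ltr_pdivlMr.
  apply: le_lt_trans; rewrite ler_norml flip andbT lerNl opprB (le_trans (flip _ _))//.
  by rewrite distrC.
pose S := [set w : 'rV[R]_n | `|w| = 1].
have cS : compact S.
  apply: bounded_closed_compact.
    by exists 1; split => // M M1 w /= ->; exact: ltW.
  apply: (@closed_comp _ _ (fun w : 'rV[R]_n => `|w|) [set 1 : R]); last exact: closed_eq.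
  by move=> w _; exact: norm_continuous.
have to_row v : exists2 w, of_row w = v & forall t, `|v t| <= `|w|.
  exists (\row_i v (enum_val i)).
    by apply/funext => t; rewrite /of_row mxE enum_rankK.
  move=> t; have := coord (\row_i v (enum_val i)) (enum_rank t).
  by rewrite mxE enum_rankK.
have f_scale (a : R) w : f (a *: w) = `|a| * f w.
  rewrite /f -nrmZ; congr nrm; apply/funext => t; by rewrite /of_row mxE.
have normalize (w : 'rV[R]_n) : w != 0 -> S (`|w|^-1 *: w).
  move=> w0; rewrite /S/= normrZ normfV normr_id mulVf//.
  by rewrite normr_eq0.
(* The sphere is empty when [T] is, and then every vector is 0. *)
have [[w1 Sw1]|S0] := pselect (S !=set0); last first.
  exists 1 => // v r; have [w <- wt] := to_row v.
  have [w0|/normalize Sw] := eqVneq w 0; last by exfalso; apply: S0; eexists; exact: Sw.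
  by rewrite w0 /of_row mxE normr0 mul1r.
have [w /set_mem Sw wmin] := EVT_min_rV (ex_intro _ w1 Sw1) cS (continuous_subspaceT cf).
have fw : 0 < f w.
  rewrite lt_def nrm_ge0 andbT; apply/eqP => fw0.
  have w0 : w = 0.
    case: nrm_norm => /(_ _ fw0) w0 _ _; apply/rowP => i.
    have := congr1 (fun g => g (enum_val i)) w0.
    by rewrite /of_row/= enum_valK mxE.
  by move: Sw; rewrite /S/= w0 normr0 => /eqP; rewrite eq_sym oner_eq0.
exists (f w)^-1; first by rewrite invr_gt0.
move=> v r; have [w' <- wt] := to_row v; apply: le_trans (wt r) _.
rewrite -/(f w'); have [->|w'0] := eqVneq w' 0.
  by rewrite normr0 mulr_ge0// ?invr_ge0 ?(ltW fw)// nrm_ge0.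
have w'n : 0 < `|w'| by rewrite normr_gt0.
have := wmin _ (mem_set (normalize _ w'0)).
rewrite f_scale ger0_norm ?invr_ge0// => h.
by rewrite ler_pdivlMl// mulrC -ler_pdivlMl.
Unshelve. all: by end_near. Qed.

End NormEquivalence.

(** * Extended real limits *)

Section EReal.
Variable R : realType.
Local Open Scope ereal_scope.
Implicit Types (u v : (\bar R)^nat).

Lemma limn_esup_le u (c : \bar R) n0 :
  (forall n, (n0 <= n)%N -> u n <= c) -> limn_esup u <= c.
Proof.
move=> uc; rewrite limn_esup_lim; apply: lime_le; first exact: is_cvg_esups.
exists n0 => // n /= n0n; apply: ge_ereal_sup => _ [k /= nk <-].
by apply: uc; exact: leq_trans nk.
Qed.

Lemma limn_einf_ge u (c : \bar R) n0 :
  (forall n, (n0 <= n)%N -> c <= u n) -> c <= limn_einf u.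
Proof.
move=> uc; rewrite limn_einf_lim; apply: lime_ge; first exact: is_cvg_einfs.
exists n0 => // n /= n0n; apply: le_ereal_inf_tmp => _ [k /= nk <-].
by apply: uc; exact: leq_trans nk.
Qed.

Lemma limn_einf_le_esup u v n0 :
  (forall n, (n0 <= n)%N -> u n <= v n) -> limn_einf u <= limn_esup v.
Proof.
move=> uv; rewrite limn_einf_lim limn_esup_lim.
apply: lee_lim; [exact: is_cvg_einfs|exact: is_cvg_esups|].
exists n0 => // n /= n0n; apply: (@le_trans _ _ (u n)).
  by apply: ereal_inf_lbound; exists n => /=.
by apply: le_trans (uv _ n0n) _; apply: ereal_sup_ubound; exists n => /=.
Qed.

Lemma le_limn_esup u v : (forall n, u n <= v n) -> limn_esup u <= limn_esup v.
Proof.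
move=> uv; rewrite !limn_esup_lim; apply: lee_lim; [exact: is_cvg_esups..|].
exists 0%N => // n _; apply: ge_ereal_sup => _ [k /= nk <-].
by apply: le_trans (uv k) _; apply: ereal_sup_ubound; exists k.
Qed.

Lemma le_limn_einf u v : (forall n, u n <= v n) -> limn_einf u <= limn_einf v.
Proof.
move=> uv; rewrite !limn_einf_lim; apply: lee_lim; [exact: is_cvg_einfs..|].
exists 0%N => // n _; apply: le_ereal_inf_tmp => _ [k /= nk <-].
by apply: le_trans (uv k); apply: ereal_inf_lbound; exists k.
Qed.

Lemma ereal_inf_image_le (T : Type) (S : set T) (f g : T -> \bar R) :
  (forall x, S x -> f x <= g x) -> ereal_inf (f @` S) <= ereal_inf (g @` S).
Proof.
move=> fg; apply: le_ereal_inf_tmp => _ [x Sx <-].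
by apply: le_trans (fg x Sx); apply: ereal_inf_lbound; exists x.
Qed.

Lemma ereal_sup_image_le (T : Type) (S : set T) (f g : T -> \bar R) :
  (forall x, S x -> f x <= g x) -> ereal_sup (f @` S) <= ereal_sup (g @` S).
Proof.
move=> fg; apply: ge_ereal_sup => _ [x Sx <-].
by apply: le_trans (fg x Sx) _; apply: ereal_sup_ubound; exists x.
Qed.

Lemma near0_right (P : R -> Prop) (d : R) : (0 < d)%R ->
  (forall t, (0 < t < d)%R -> P t) -> \forall t \near 0%R^'+, P t.
Proof.
move=> d0 dP; near=> t; apply: dP; apply/andP; split; first by near: t; exact: nbhs_right_gt.
by near: t; exact: nbhs_right_lt.
Unshelve. all: by end_near. Qed.

Lemma cvg_right0_nd (f : R -> \bar R) :
  (forall s t, (0 < s)%R -> (s <= t)%R -> f s <= f t) -> cvg (f t @[t --> 0%R^'+]).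
Proof.
move=> fnd; apply: nondecreasing_at_right_is_cvge.
apply: (@near0_right _ 1) => // t _ x y; rewrite !in_itv/= => /andP[x0 _] _ xy.
exact: fnd.
Qed.

Lemma cvg_right0_ni (f : R -> \bar R) :
  (forall s t, (0 < s)%R -> (s <= t)%R -> f t <= f s) -> cvg (f t @[t --> 0%R^'+]).
Proof.
move=> fni; apply: nonincreasing_at_right_is_cvge.
apply: (@near0_right _ 1) => // t _ x y; rewrite !in_itv/= => /andP[x0 _] _ xy.
exact: fni.
Qed.

Lemma lim_right0_le (f g : R -> \bar R) :
  cvg (f t @[t --> 0%R^'+]) -> cvg (g t @[t --> 0%R^'+]) ->
  (forall t, (0 < t)%R -> f t <= g t) ->
  lim (f t @[t --> 0%R^'+]) <= lim (g t @[t --> 0%R^'+]).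
Proof.
move=> cf cg fg; apply: lee_lim => //.
by apply: (@near0_right _ 1) => // t /andP[t0 _]; exact: fg.
Qed.

Lemma lim_right0_between (f : R -> \bar R) (lo hi : \bar R) (d : R) :
  cvg (f t @[t --> 0%R^'+]) -> (0 < d)%R ->
  (forall t, (0 < t < d)%R -> lo <= f t <= hi) ->
  lo <= lim (f t @[t --> 0%R^'+]) <= hi.
Proof.
move=> cf d0 fb; apply/andP; split.
  by apply: lime_ge => //; apply: (near0_right d0) => t /fb/andP[].
by apply: lime_le => //; apply: (near0_right d0) => t /fb/andP[].
Qed.

Lemma cvg_right0_fin (f : R -> \bar R) (l : R) :
  (forall e : R, (0 < e)%R -> \forall t \near 0%R^'+, `|f t - l%:E| < e%:E) ->
  f t @[t --> 0%R^'+] --> l%:E.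
Proof.
move=> H.
have fin t : `|f t - l%:E| < 1%:E -> f t \is a fin_num.
  by case: (f t) => [x| |] //=; rewrite ?addye ?addNye//= ltNge leey.
apply/fine_cvgP; split.
  by near=> t; apply: fin; near: t; exact: H.
apply/cvgrPdist_lt => e e0; near=> t.
have : f t \is a fin_num by apply: fin; near: t; exact: H.
have : `|f t - l%:E| < e%:E by near: t; exact: H.
by rewrite /=; case: (f t) => [x| |]//=; rewrite lte_fin distrC.
Unshelve. all: by end_near. Qed.

End EReal.

(** * Iterated limits *)

Section Limits.
Variables (R : realType) (N : nat) (C : 'I_N -> R) (lam mu : route N -> R).
Hypotheses (C_gt0 : forall i, 0 < C i) (lam_ge0 : forall r, 0 <= lam r).
Hypothesis mu_gt0 : forall r, 0 < mu r.
Local Notation state := (act lam -> nat).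
Local Notation vec := (act lam -> R).
Variable nrm : vec -> R.

(** The existence of the limits in [delta] rests on this monotonicity. *)
Lemma Pk_mono T (a D : vec) (c c' : R) : c <= c' -> forall k (z : state) s,
  (Pk C mu nrm k T a D c z s <= Pk C mu nrm k T a D c' z s)%E.
Proof.
move=> cc.
have tc z s u : (`[< tube nrm a D c z s u >])%:R <= (`[< tube nrm a D c' z s u >])%:R :> R.
  case: asboolP => // ct; rewrite asboolT// => t st.
  exact: lt_le_trans (ct t st) cc.
have ec (z : state) s u :
    ((expR (- qrate C mu z * (u - s)) * (`[< tube nrm a D c z s u >])%:R)%:E <=
     (expR (- qrate C mu z * (u - s)) * (`[< tube nrm a D c' z s u >])%:R)%:E)%E.
  by rewrite lee_fin ler_wpM2l ?expR_ge0.
elim=> [|k IH] z s /=; first exact: ec.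
have P0 c'' (z' : state) u : (0 <= Pk C mu nrm k T a D c'' z' u)%E by exact: Pk_ge0.
have m0 r : 0 <= muX C mu (embed z) r by apply: muX_ge0 => // r'; exact: embed_ge0.
have S0 c'' u : (0 <= \sum_(r : act lam)
    ((lam (val r))%:E * Pk C mu nrm k T a D c'' (up z r) u +
     (muX C mu (embed z) r)%:E * Pk C mu nrm k T a D c'' (down z r) u))%E.
  by apply: sume_ge0 => r _; apply: adde_ge0; apply: mule_ge0; rewrite ?lee_fin ?lam_ge0.
apply: leeD; first exact: ec.
apply: ge0_integral_mono => u _.
  by apply: mule_ge0; [rewrite lee_fin mulr_ge0// expR_ge0|exact: S0].
apply: lee_pmul; [by rewrite lee_fin mulr_ge0// expR_ge0|exact: S0|exact: ec|].
apply: lee_sum => r _; apply: leeD; apply: lee_wpmul2l; rewrite ?lee_fin ?lam_ge0 ?m0// IH.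
Qed.

Lemma logP_mono (x D : vec) tau d d' n (y : state) : 0 <= tau -> d <= d' ->
  (logP C mu nrm x D tau d n y <= logP C mu nrm x D tau d' n y)%E.
Proof.
move=> t0 dd; have nt : 0 <= n%:R * tau by rewrite mulr_ge0.
apply: elog_mono; [exact: tubeProb_ge0| |exact: tubeProb_le1].
apply: ge_ereal_sup => _ [k _ <-].
apply: (@le_trans _ _ (Pk C mu nrm k (n%:R * tau) (fun r => (n%:R * x r)%R) D (d' * n%:R) y 0)).
  by apply: Pk_mono; rewrite ler_wpM2r.
by apply: ereal_sup_ubound; exists k.
Qed.

Lemma startset_mono (x : vec) e e' n : e <= e' -> startset nrm x e n `<=` startset nrm x e' n.
Proof. by move=> ee y /= /lt_le_trans; apply; rewrite ler_wpM2r. Qed.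

Let inv_ge0 n (tau : R) : 0 <= tau -> (0 <= ((n%:R * tau)^-1)%:E)%E.
Proof. by move=> t0; rewrite lee_fin invr_ge0 mulr_ge0. Qed.

(** A smaller start set raises the infimum and lowers the supremum, so the limits in [eps] exist in
    the extended reals without any estimate. *)
Lemma J1inf_eps (x D : vec) tau d e e' : 0 <= tau -> e <= e' ->
  (J1inf C mu nrm x D tau d e' <= J1inf C mu nrm x D tau d e)%E.
Proof.
move=> t0 ee; apply: le_limn_einf => n; apply: lee_wpmul2l; first exact: inv_ge0.
by apply: ereal_inf_le_tmp; apply: image_subset; exact: startset_mono.
Qed.

Lemma J1sup_eps (x D : vec) tau d e e' : 0 <= tau -> e <= e' ->
  (J1sup C mu nrm x D tau d e <= J1sup C mu nrm x D tau d e')%E.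
Proof.
move=> t0 ee; apply: le_limn_esup => n; apply: lee_wpmul2l; first exact: inv_ge0.
by apply: ereal_sup_le; apply: image_subset; exact: startset_mono.
Qed.

Lemma J1inf_delta (x D : vec) tau d d' e : 0 <= tau -> d <= d' ->
  (J1inf C mu nrm x D tau d e <= J1inf C mu nrm x D tau d' e)%E.
Proof.
move=> t0 dd; apply: le_limn_einf => n; apply: lee_wpmul2l; first exact: inv_ge0.
by apply: ereal_inf_image_le => y _; exact: logP_mono.
Qed.

Lemma J1sup_delta (x D : vec) tau d d' e : 0 <= tau -> d <= d' ->
  (J1sup C mu nrm x D tau d e <= J1sup C mu nrm x D tau d' e)%E.
Proof.
move=> t0 dd; apply: le_limn_esup => n; apply: lee_wpmul2l; first exact: inv_ge0.
by apply: ereal_sup_image_le => y _; exact: logP_mono.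
Qed.

Lemma cvg_J1inf (x D : vec) tau d : 0 <= tau -> cvg (J1inf C mu nrm x D tau d eps @[eps --> 0^'+]).
Proof. by move=> t0; apply: cvg_right0_ni => s t _; exact: J1inf_eps. Qed.

Lemma cvg_J1sup (x D : vec) tau d : 0 <= tau -> cvg (J1sup C mu nrm x D tau d eps @[eps --> 0^'+]).
Proof. by move=> t0; apply: cvg_right0_nd => s t _; exact: J1sup_eps. Qed.

Lemma cvg_J2inf (x D : vec) tau : 0 <= tau -> cvg (J2inf C mu nrm x D tau d @[d --> 0^'+]).
Proof.
move=> t0; apply: cvg_right0_nd => s t _ st.
by apply: lim_right0_le => [||e _]; [exact: cvg_J1inf..|exact: J1inf_delta].
Qed.

Lemma cvg_J2sup (x D : vec) tau : 0 <= tau -> cvg (J2sup C mu nrm x D tau d @[d --> 0^'+]).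
Proof.
move=> t0; apply: cvg_right0_nd => s t _ st.
by apply: lim_right0_le => [||e _]; [exact: cvg_J1sup..|exact: J1sup_delta].
Qed.

Hypothesis nrm_norm : is_norm nrm.
Hypothesis erg : ergodic C lam mu.

(** Over an empty start set the infimum would exceed the supremum. Rounding [n * x] down errs by at
    most 1 in each coordinate, which is below [e * n] in norm for large [n]. *)
Lemma startset_nonempty (x : vec) e : (forall r, 0 <= x r) -> 0 < e ->
  exists n0, forall n, (n0 <= n)%N -> startset nrm x e n !=set0.
Proof.
move=> x0 e0; have [c c0 Hc] := norm_le_sup nrm_norm.
exists (Num.bound (c / e)) => n nb; exists (fun r => Num.truncn (n%:R * x r)).
rewrite /startset/=; apply: (@le_lt_trans _ _ (c * 1)).
  apply: Hc => // r; rewrite /embed distrC ger0_norm.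
    have := @truncn_itv _ (n%:R * x r) (mulr_ge0 (ler0n _ _) (x0 r)).
    by move=> /andP[_]; rewrite -natr1 lerBlDl => /ltW.
  have := @truncn_itv _ (n%:R * x r) (mulr_ge0 (ler0n _ _) (x0 r)).
  by move=> /andP[? _]; rewrite subr_ge0.
rewrite mulr1 mulrC -ltr_pdivrMr//; apply: lt_le_trans (archi_boundP _) _.
  by rewrite divr_ge0// ltW.
by rewrite ler_nat.
Qed.

Lemma J1inf_le_sup (x D : vec) tau d e : (forall r, 0 <= x r) -> 0 <= tau -> 0 < e ->
  (J1inf C mu nrm x D tau d e <= J1sup C mu nrm x D tau d e)%E.
Proof.
move=> x0 t0 /(startset_nonempty x0)[n0 H].
apply: (@limn_einf_le_esup _ _ _ n0) => n /H[y ys].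
apply: lee_wpmul2l; first exact: inv_ge0.
apply: (@le_trans _ _ (logP C mu nrm x D tau d n y)).
  by apply: ereal_inf_lbound; exists y.
by apply: ereal_sup_ubound; exists y.
Qed.

(** The lower bound is proved for the infimum and the upper bound for the supremum; [J1inf_le_sup]
    gives both bounds to both quantities, and they survive the limits in [eps] and [delta]. *)
Lemma J3_bounds (L : pred (act lam)) (D : vec) (m B e : R) :
  in_span L D -> 0 < m -> 0 < e ->
  exists2 tau0, 0 < tau0 & forall tau, 0 < tau < tau0 ->
    forall x : vec, face L x -> (forall r, L r -> m <= x r <= B) ->
    ((- Lrate C mu x D - e)%:E <= J3inf C mu nrm x D tau <= (- Lrate C mu x D + e)%:E)%E /\
    ((- Lrate C mu x D - e)%:E <= J3sup C mu nrm x D tau <= (- Lrate C mu x D + e)%:E)%E.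
Proof.
move=> LD m0 e0.
have [c1 c10 Hc1] := norm_le_sup nrm_norm.
have [c0 c00 Hc0] := sup_le_norm nrm_norm.
have [ta ta0 Hup] := logP_upper C_gt0 lam_ge0 mu_gt0 c00 Hc0 B LD m0 e0.
have [tb tb0 Hlo] := logP_lower C_gt0 lam_ge0 mu_gt0 erg c00 c10 Hc0 Hc1 B LD m0 e0.
exists (Num.min ta tb); first by rewrite lt_min ta0.
move=> tau /andP[t0]; rewrite lt_min => /andP[tta ttb] x xL xmB.
have x0 := face_ge0 xL.
have {Hup} [da da0 Hup] := Hup tau (introT andP (conj t0 tta)) x xL xmB.
have {}Hlo := Hlo tau (introT andP (conj t0 ttb)) x xL xmB.
have bnd d : 0 < d < da -> exists2 eps0, 0 < eps0 & forall eps, 0 < eps < eps0 ->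
    ((- Lrate C mu x D - e)%:E <= J1inf C mu nrm x D tau d eps)%E /\
    (J1sup C mu nrm x D tau d eps <= (- Lrate C mu x D + e)%:E)%E.
  move=> dda; have /andP[d0 _] := dda.
  have [eps0 eps00 {}Hlo] := Hlo d d0.
  exists (Num.min d eps0); first by rewrite lt_min d0.
  (* [eps < d] puts the start set inside the one of radius [d] for which the upper bound is
     stated. *)
  move=> eps /andP[ep0]; rewrite lt_min => /andP[epd epe]; split.
    have [n0 H] := Hlo eps (introT andP (conj ep0 epe)).
    apply: (@limn_einf_ge _ _ _ n0.+1) => n n0n.
    have n_gt0 : 0 < n%:R * tau by rewrite mulr_gt0// ltr0n (leq_trans _ n0n).
    rewrite /seq_inf lee_pdivlMl// -EFinM; apply: le_ereal_inf_tmp => _ [y ys <-].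
    by apply: H => //; exact: ltnW.
  apply: (@limn_esup_le _ _ _ 1) => n n1.
  have n_gt0 : 0 < n%:R * tau by rewrite mulr_gt0// ltr0n.
  rewrite /seq_sup lee_pdivrMl// -EFinM; apply: ge_ereal_sup => _ [y ys <-].
  by apply: (Hup d dda) => //; apply: startset_mono ys; exact: ltW.
have t0' := ltW t0.
split; apply: (lim_right0_between _ da0); [exact: cvg_J2inf| |exact: cvg_J2sup|]
  => d /bnd[ep ep0 H].
- apply: (lim_right0_between _ ep0); first exact: cvg_J1inf.
  move=> eps he; have [h1 h2] := H eps he; rewrite h1/=; apply: le_trans h2.
  by apply: J1inf_le_sup => //; case/andP: he.
- apply: (lim_right0_between _ ep0); first exact: cvg_J1sup.
  move=> eps he; have [h1 h2] := H eps he; rewrite h2 andbT; apply: le_trans h1 _.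
  by apply: J1inf_le_sup => //; case/andP: he.
Qed.

(** Coordinates are continuous for the product topology and attain their extrema on [K]; the minima
    over [L] are positive because they are attained on the face. *)
Lemma compact_face_bounds (L : pred (act lam)) (K : set vec) :
  K `<=` face L -> compact (K : set {ptws act lam -> R}) ->
  exists m B, 0 < m /\ forall x, K x -> forall r, L r -> m <= x r <= B.
Proof.
move=> KL cK; have [[x1 Kx1]|K0] := pselect (K !=set0); last first.
  by exists 1, 1; split => // x Kx; exfalso; apply: K0; exists x.
have ct (r : act lam) :
    {within (K : set {ptws act lam -> R}), continuous (fun x : {ptws act lam -> R} => x r)}.
  by apply: continuous_subspaceT; exact: (@proj_continuous _ (fun=> R) r).
have K1 : (K : set {ptws act lam -> R}) !=set0 by exists x1.
have lo r : exists2 b, 0 < b & forall x, K x -> L r -> b <= x r.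
  have [xm /set_mem Kxm xmP] := compact_EVT_min K1 cK (ct r).
  have [Lr|nL] := boolP (L r); last by exists 1.
  exists (xm r); first by case: (KL _ Kxm r) => -[]//; rewrite Lr.
  by move=> x Kx _; apply: xmP; exact: mem_set.
have hi r : exists b, forall x, K x -> x r <= b.
  have [xm /set_mem Kxm xmP] := compact_EVT_max K1 cK (ct r).
  by exists (xm r) => x Kx; apply: xmP; exact: mem_set.
have /choice[f Hf] : forall r, exists b, 0 < b /\ forall x, K x -> L r -> b <= x r.
  by move=> r; have [b b0 Hb] := lo r; exists b.
have /choice[g Hg] := hi.
have [m m0 Hm] := exists_lower_bound (fun r => proj1 (Hf r)).
exists m, (\sum_r `|g r|); split => // x Kx r Lr; apply/andP; split.
  exact: le_trans (Hm r) (proj2 (Hf r) x Kx Lr).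
apply: le_trans (Hg r x Kx) (le_trans (ler_norm _) _).
exact: (@ler_sumT _ _ (fun r => `|g r|)).
Qed.

Lemma J3_uniform (L : pred (act lam)) (D : vec) (K : set vec) :
  in_span L D -> K `<=` face L -> compact (K : set {ptws act lam -> R}) ->
  forall e : R, 0 < e -> \forall tau \near 0^'+, forall x, K x ->
    (`| J3inf C mu nrm x D tau - (- Lrate C mu x D)%:E | < e%:E)%E /\
    (`| J3sup C mu nrm x D tau - (- Lrate C mu x D)%:E | < e%:E)%E.
Proof.
move=> LD KL cK e e0; have [m [B [m0 HmB]]] := compact_face_bounds KL cK.
have [tau0 tau00 H] := J3_bounds B LD m0 (divr_gt0 e0 (ltr0n R 2 : 0 < 2)).
apply: (near0_right tau00) => tau ht x Kx.
have [h1 h2] := H tau ht x (KL x Kx) (HmB x Kx).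
have fin (J : \bar R) : ((- Lrate C mu x D - e / 2)%:E <= J <= (- Lrate C mu x D + e / 2)%:E)%E ->
    (`|J - (- Lrate C mu x D)%:E| < e%:E)%E.
  case: J => [j| |].
  - rewrite !lee_fin lte_fin => /andP[j1 j2].
    by rewrite ltr_norml; apply/andP; split; lra.
  - by rewrite leye_eq andbF.
  - by rewrite leeNy_eq.
by split; apply: fin.
Qed.

End Limits.

Theorem theorem1p2 (R : realType) (N : nat) (C : 'I_N -> R)
    (lam mu : route N -> R) (nrm : (act lam -> R) -> R) :
  (forall i, 0 < C i) ->
  (forall r, 0 <= lam r) ->
  (forall r, 0 < mu r) ->
  is_norm nrm ->
  ergodic C lam mu ->
  (forall (x D : act lam -> R),
     (forall r, 0 <= x r) -> in_span (supp x) D ->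
     [/\ (forall tau delta, 0 < tau -> 0 < delta ->
            J1inf C mu nrm x D tau delta eps @[eps --> 0^'+]
              --> J2inf C mu nrm x D tau delta),
         (forall tau, 0 < tau ->
            J2inf C mu nrm x D tau delta @[delta --> 0^'+]
              --> J3inf C mu nrm x D tau) &
         J3inf C mu nrm x D tau @[tau --> 0^'+] --> (- Lrate C mu x D)%:E] /\
     [/\ (forall tau delta, 0 < tau -> 0 < delta ->
            J1sup C mu nrm x D tau delta eps @[eps --> 0^'+]
              --> J2sup C mu nrm x D tau delta),
         (forall tau, 0 < tau ->
            J2sup C mu nrm x D tau delta @[delta --> 0^'+]
              --> J3sup C mu nrm x D tau) &
         J3sup C mu nrm x D tau @[tau --> 0^'+] --> (- Lrate C mu x D)%:E])
  /\
  (forall (L : pred (act lam)) (D : act lam -> R) (K : set (act lam -> R)),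
     in_span L D ->
     K `<=` face L ->
     compact (K : set {ptws act lam -> R}) ->
     forall e : R, 0 < e ->
       \forall tau \near 0^'+, forall x, K x ->
          (`| J3inf C mu nrm x D tau - (- Lrate C mu x D)%:E | < e%:E)%E /\
          (`| J3sup C mu nrm x D tau - (- Lrate C mu x D)%:E | < e%:E)%E).
Proof.
move=> C_gt0 lam_ge0 mu_gt0 nrm_norm erg; split; last first.
  by move=> L D K LD KL cK;
    exact: (J3_uniform C_gt0 lam_ge0 mu_gt0 nrm_norm erg LD KL cK).
move=> x D x0 xD.
(* The pointwise limits are the uniform statement for the compact set consisting of [x] alone,
   inside its own face. *)
have xface : [set x] `<=` face (supp x).
  move=> _ -> r; rewrite /supp; have := x0 r; rewrite le_eqVlt => /predU1P[<-|->].
    by right; rewrite ltxx.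
  by left.
have cx : compact ([set x] : set {ptws act lam -> R}) by exact: compact_set1.
have unif := J3_uniform C_gt0 lam_ge0 mu_gt0 nrm_norm erg
  xD xface cx.
split; split.
- by move=> tau d t0 _; apply: cvg_J1inf => //; exact: ltW.
- by move=> tau t0; apply: cvg_J2inf => //; exact: ltW.
- by apply: cvg_right0_fin => e /unif; apply: filterS => tau /(_ x erefl)[h _]; exact: h.
- by move=> tau d t0 _; apply: cvg_J1sup => //; exact: ltW.
- by move=> tau t0; apply: cvg_J2sup => //; exact: ltW.
- by apply: cvg_right0_fin => e /unif; apply: filterS => tau /(_ x erefl)[_ h]; exact: h.
Qed.
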